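(* Let $a\in[\frac{2\pi}{5},\frac{\pi}{2})$ be fixed, and let $Q$ and $\widetilde Q$ be two potential matrices of the form described in the context, with entries $q,p$ and $\widetilde q,\widetilde p$ respectively. For $j=1,2$ let $\{\lambda_{n,2,j}\}_{n\in\mathbb{Z}}$ and $\{\widetilde\lambda_{n,2,j}\}_{n\in\mathbb{Z}}$ be the spectra of the boundary value problems $B_{2,j}(Q)$ and $B_{2,j}(\widetilde Q)$, respectively. If $\lambda_{n,2,1}=\widetilde{\lambda}_{n,2,1}$ and $\lambda_{n,2,2}=\widetilde{\lambda}_{n,2,2}$ for all $n\in\mathbb{Z}$, then $q(x)=\widetilde{q}(x)$ and $p(x)=\widetilde{p}(x)$ a.e. on $[a,\pi]$. That is, the specification of the two spectra $\{\lambda_{n,2,j}\}_{n\in\mathbb{Z}}$, $j=1,2$, uniquely determines the potentials $q$ and $p$.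
   Context: Consider the Dirac-type system with constant delay $a$: $$By'(x)+Q(x)y(x-a)=\lambda y(x),\quad x\in(0,\pi),$$ where $$B=\begin{bmatrix} 0 & 1 \\ -1 & 0 \end{bmatrix},\quad Q(x)=\begin{bmatrix} q(x) & p(x) \\ p(x) & -q(x) \end{bmatrix},\quad y(x)=\begin{bmatrix} y_1(x) \\ y_2(x) \end{bmatrix},$$ $q,p$ are complex-valued functions in $L_2(0,\pi)$, and $Q(x)=0$ on $(0,a)$ (so the values of $y$ at negative arguments play no role). For $\nu,j\in\{1,2\}$, $B_{\nu,j}(Q)$ denotes the boundary value problem for this system with boundary conditions $y_\nu(0)=0$, $y_j(\pi)=0$. The problem $B_{\nu,j}(\widetilde Q)$ has the same form (same $a$), with $\widetilde Q=\begin{bmatrix} \widetilde q & \widetilde p \\ \widetilde p & -\widetilde q \end{bmatrix}$ satisfying the same assumptions. Let $Y(x,\lambda)=[y_{k,l}(x,\lambda)]_{k,l=1,2}$ be the fundamental matrix solution of the system with $Y(0,\lambda)$ equal to the identity matrix. The eigenvalues of $B_{\nu,j}(Q)$ are the zeros of its characteristic function, the entire function $\Delta_{\nu,j}(\lambda)=y_{j,3-\nu}(\pi,\lambda)$. The spectrum $\{\lambda_{n,\nu,j}\}_{n\in\mathbb{Z}}$ of $B_{\nu,j}(Q)$ is the sequence of these zeros, counted with multiplicity and numbered so that $$\lambda_{n,\nu,j}=n+\frac{2-\nu-j}{2}+\kappa_{n,\nu,j},\quad\{\kappa_{n,\nu,j}\}_{n\in\mathbb{Z}}\in l_2$$ (such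 a numbering always exists). *)

(* Defs.v *)
From HB Require Import structures.
From mathcomp Require Import all_boot all_order all_algebra.
From mathcomp Require Import all_classical all_reals all_analysis.
From mathcomp Require Export complex.

Set Implicit Arguments.
Unset Strict Implicit.
Unset Printing Implicit Defensive.

Import Order.TTheory GRing.Theory Num.Theory numFieldNormedType.Exports.

Local Open Scope classical_set_scope.
Local Open Scope ring_scope.
Local Open Scope complex_scope.

Section DiracDelay.
Context {R : realType}.

Local Notation C := (R[i]).
Local Notation mu := (@lebesgue_measure R).

(* f is an (everywhere defined) representative of an element of L_2(D; C). *)
Definition L2 (D : set R) (f : R -> C) : Prop :=
  [/\ measurable_fun D (fun x => complex.Re (f x)),
      measurable_fun D (fun x => complex.Im (f x)) &
      (\int[mu]_(x in D) ((Normc.normc (f x)) ^+ 2)%:E < +oo)%E].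

Definition abs_continuous (a b : R) (f : R -> R) : Prop :=
  forall e : R, 0 < e -> exists2 d : R, 0 < d &
    forall (n : nat) (u v : 'I_n -> R),
      (forall k, [/\ a <= u k, u k <= v k & v k <= b]) ->
      classical_sets.trivIset setT (fun k => `]u k, v k[%classic) ->
      \sum_(k < n) (v k - u k) < d ->
      \sum_(k < n) `|f (v k) - f (u k)| < e.

Definition abs_continuousC (a b : R) (f : R -> C) : Prop :=
  abs_continuous a b (fun x => complex.Re (f x)) /\
  abs_continuous a b (fun x => complex.Im (f x)).

(* df is the derivative at the real point x of the complex-valued f. *)
Definition is_deriveC (x : R) (f : R -> C) (df : C) : Prop :=
  is_derive x (1 : R) (fun t => complex.Re (f t)) (complex.Re df) /\
  is_derive x (1 : R) (fun t => complex.Im (f t)) (complex.Im df).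

Definition mx2 (a b c d : C) : 'M[C]_2 :=
  \matrix_(i, j) if i == 0 then (if j == 0 then a else b)
                 else (if j == 0 then c else d).

Definition Bmx : 'M[C]_2 := mx2 0 1 (-1) 0.

Definition Qmx (q p : R -> C) (x : R) : 'M[C]_2 :=
  mx2 (q x) (p x) (p x) (- q x).

Definition admissible (a : R) (q p : R -> C) : Prop :=
  [/\ L2 `]0, pi[%classic q, L2 `]0, pi[%classic p &
      {ae mu, forall x, x \in `]0, a[ -> Qmx q p x = 0}].

(* Absolutely continuous solutions of the system a.e., m columns at once. For
   a.e. x < a the delay term is multiplied by Qmx q p x = 0, so the values of
   y at negative arguments play no role. *)
Definition solution (a : R) (q p : R -> C) (l : C) (m : nat)
    (y : R -> 'M[C]_(2, m)) : Prop :=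
  (forall i j, abs_continuousC 0 pi (fun x => y x i j)) /\
  {ae mu, forall x, x \in `]0, pi[ ->
    exists2 dy : 'M[C]_(2, m),
      (forall i j, is_deriveC x (fun t => y t i j) (dy i j)) &
      Bmx *m dy + Qmx q p x *m y (x - a) = l *: y x}.

Definition fundamental_matrix (a : R) (q p : R -> C)
    (Y : R -> C -> 'M[C]_2) : Prop :=
  forall l : C, solution a q p l (fun x => Y x l) /\ Y 0 l = 1%:M.

(* One-based indexing: idx 1 and idx 2 are the two elements of 'I_2. *)
Definition idx (k : nat) : 'I_2 := inord k.-1.

Definition char_fun (Y : R -> C -> 'M[C]_2) (nu j : nat) (l : C) : C :=
  Y pi l (idx j) (idx (3 - nu)%N).

(* For an entire function D: D = (w - z)^m g with g entire and g z != 0, i.e.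
   D vanishes to order exactly m at z; m = 0 means D z != 0. The regular
   algebra C^o carries the norm topology and makes derivable complex
   differentiability. *)
Definition zero_order (D : C -> C) (z : C) (m : nat) : Prop :=
  exists g : C^o -> C^o,
    [/\ forall w : C^o, derivable g w 1, g z != 0 &
        forall w : C, D w = (w - z) ^+ m * g w].

(* lam lists the zeros of the characteristic function: every z occurs as often
   as its multiplicity (never, when z is not a zero), and the numbering has
   square-summable remainders. *)
Definition is_spectrum (a : R) (q p : R -> C) (nu j : nat)
    (lam : int -> C) : Prop :=
  exists Y : R -> C -> 'M[C]_2,
    [/\ fundamental_matrix a q p Y,
        forall z : C, exists2 m : nat,
          zero_order (char_fun Y nu j) z m & ([set n | lam n = z] #= `I_m)%card &
        summable [set: int] (fun n =>
          ((Normc.normc (lam n - (n%:~R + (2%:R - nu%:R - j%:R) / 2%:R)))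
             ^+ 2)%:E)].

End DiracDelay.

(* Main.v *)
(* Write [u = y11 + i y21], [v = y11 - i y21], [f = p - i q], [g = p + i q]. The
   system becomes [u' = i l u + f v(. - a)], [v' = - i l v + g u(. - a)], and as
   [pi <= 3 a] its Neumann series stops at the quadratic term:
     [u(pi) = e^(i l pi) + int f(t) e^(i l (pi + a - 2 t)) dt
              + iint_(s <= t - a) f(t) g(s) e^(i l (pi - 2 (t - s))) ds dt],
   and similarly for [v] with [f], [g] exchanged and [l] replaced by [- l]. All
   phases lie in [-b, b] with [b = pi - a <= 3 pi / 5 < 2].

   Equal spectra: the difference [D] of two characteristic functions is a
   bounded functional on [C([-b, b])] applied to exponentials, and it vanishes
   at the [l_n] with multiplicity. Newton interpolation of [e^(i l x)] at the
   first [m] nodes [l_n = n + O(1)] has an error of order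
   [prod_(j < m) (j / 2 + O(1)) * b^m / m!], which tends to [0] because
   [b < 2]; hence [D = 0] without any appeal to complex function theory.

   Equal functionals: testing with [exp (- exp (N (x - c)))], a series of real
   exponentials, and letting [N] tend to infinity gives equality on half lines.
   For [t] in [(a, 3 a / 2)] or [(pi - a / 2, pi)] the double integral then does
   not depend on [c], so [f] and [g] are determined there. As [2 a >= pi - a / 2]
   and [pi - a <= 3 a / 2], these values determine the double integral, hence
   [f] and [g] everywhere. *)
Require Import Defs.
From mathcomp Require Import all_boot all_order all_algebra.
From mathcomp Require Import all_classical all_reals all_analysis.
From mathcomp Require Import measurable_realfun ring lra.

Set Implicit Arguments.
Unset Strict Implicit.
Unset Printing Implicit Defensive.

Import Order.TTheory GRing.Theory Num.Theory numFieldNormedType.Exports.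
Local Open Scope classical_set_scope.
Local Open Scope ring_scope.
Local Open Scope complex_scope.

(** * Complex exponentials and derivatives *)

Section ComplexFacts.
Context {R : realType}.
Local Notation C := (R[i]).
Implicit Types (z w : C).

(** At [pi] the two characteristic functions are [(u + v) / 2] and [(u - v) / (2 i)]. Neither [u]
    nor [v] alone is controlled at the zeros, so both combinations are interpolated, [v] with its
    exponent [- i l] entering through the reflected test function; a sum and a difference at the end
    separate the two.

    The nodes are [i l_n], taken along [0, -1, 1, -2, 2, ...], which is the source of [j / 2]. Their
    real parts are bounded, so the error carries only a fixed exponential factor. Divided
    differences of [e^(w x)] in [w] are iterated solutions of [G' = z G + ...] in [x], hence
    calculus in one real variable estimates them. As [D] then vanishes at every complex argument,
    real exponentials become available as test functions.

    On the support of the quadratic kernel [a <= t - s < pi - a], so its phases lie in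
    [(2 a - pi, pi - 2 a]]. The phase [pi + a - 2 t] of the linear term is above this window exactly
    for [t < 3 a / 2], and not above its lower end exactly for [t >= pi - a / 2]. The closing
    inequalities and [b <= 3 pi / 5] are all the single condition [2 pi <= 5 a]. *)

Lemma Re_mk (x y : R) : complex.Re (x +i* y) = x. Proof. by []. Qed.
Lemma Im_mk (x y : R) : complex.Im (x +i* y) = y. Proof. by []. Qed.

Lemma Re_add z w : complex.Re (z + w) = complex.Re z + complex.Re w.
Proof. by case: z w => [? ?] [? ?]. Qed.
Lemma Im_add z w : complex.Im (z + w) = complex.Im z + complex.Im w.
Proof. by case: z w => [? ?] [? ?]. Qed.
Lemma Re_opp z : complex.Re (- z) = - complex.Re z.
Proof. by case: z. Qed.
Lemma Im_opp z : complex.Im (- z) = - complex.Im z.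
Proof. by case: z. Qed.
Lemma Re_mul z w : complex.Re (z * w) =
  complex.Re z * complex.Re w - complex.Im z * complex.Im w.
Proof. by case: z w => [? ?] [? ?]. Qed.
Lemma Im_mul z w : complex.Im (z * w) =
  complex.Re z * complex.Im w + complex.Im z * complex.Re w.
Proof. by case: z w => [? ?] [? ?]. Qed.

Lemma complex_eq z w :
  complex.Re z = complex.Re w -> complex.Im z = complex.Im w -> z = w.
Proof. by case: z w => [? ?] [? ?] /= -> ->. Qed.

Lemma normc_sqrt z :
  Normc.normc z = Num.sqrt (complex.Re z ^+ 2 + complex.Im z ^+ 2).
Proof. by case: z. Qed.

Lemma normc_ge0 z : 0 <= Normc.normc z.
Proof. by rewrite normc_sqrt sqrtr_ge0. Qed.

Lemma normc_Re z : `|complex.Re z| <= Normc.normc z.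
Proof.
by rewrite normc_sqrt -sqrtr_sqr ler_sqrt ?lerDl ?sqr_ge0 // addr_ge0 ?sqr_ge0.
Qed.

Lemma normc_Im z : `|complex.Im z| <= Normc.normc z.
Proof.
by rewrite normc_sqrt -sqrtr_sqr ler_sqrt ?lerDr ?sqr_ge0 // addr_ge0 ?sqr_ge0.
Qed.

Lemma normc_real (x : R) : Normc.normc (x%:C) = `|x|.
Proof. by rewrite normc_sqrt /= expr0n addr0 sqrtr_sqr. Qed.

Lemma normc_le z : Normc.normc z <= `|complex.Re z| + `|complex.Im z|.
Proof.
rewrite normc_sqrt -[leRHS]ger0_norm ?addr_ge0// -sqrtr_sqr ler_sqrt ?sqr_ge0//.
rewrite sqrrD -(real_normK (num_real (complex.Re z))).
rewrite -(real_normK (num_real (complex.Im z))).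
have h1 := normr_ge0 (complex.Re z); have h2 := normr_ge0 (complex.Im z).
nra.
Qed.

Lemma normcD z w : Normc.normc (z + w) <= Normc.normc z + Normc.normc w.
Proof. exact: le_normcD. Qed.

Lemma normc_opp z : Normc.normc (- z) = Normc.normc z.
Proof. exact: normcN. Qed.

Lemma normc_prod (I : Type) (s : seq I) (F : I -> C) :
  Normc.normc (\prod_(i <- s) F i) = \prod_(i <- s) Normc.normc (F i).
Proof.
elim/big_ind2 : _ => //; first by rewrite Normc.normc1.
by move=> x1 x2 y1 y2 <- <-; rewrite Normc.normcM.
Qed.

Definition cexp z : C :=
  (expR (complex.Re z) * cos (complex.Im z)) +i*
  (expR (complex.Re z) * sin (complex.Im z)).

Lemma cexp0 : cexp 0 = 1.
Proof. by apply: complex_eq; rewrite /= ?expR0 ?cos0 ?sin0 ?mul1r. Qed.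

Lemma cexpD z w : cexp (z + w) = cexp z * cexp w.
Proof.
by apply: complex_eq; rewrite ?Re_mul ?Im_mul /cexp Re_mk Im_mk Re_add Im_add expRD ?cosD ?sinD;
  rewrite ?Re_mk ?Im_mk; ring.
Qed.

Lemma normc_cexp z : Normc.normc (cexp z) = expR (complex.Re z).
Proof.
rewrite normc_sqrt /cexp /= !exprMn -mulrDr cos2Dsin2 mulr1 sqrtr_sqr.
by rewrite ger0_norm // expR_ge0.
Qed.

Lemma cexp_real (x : R) : cexp (x%:C) = (expR x)%:C.
Proof. by apply: complex_eq; rewrite /= ?cos0 ?sin0 ?mulr1 ?mulr0. Qed.

Lemma is_deriveCD (x : R) (f g : R -> C) df dg :
  is_deriveC x f df -> is_deriveC x g dg ->
  is_deriveC x (fun t => f t + g t) (df + dg).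
Proof.
move=> [f1 f2] [g1 g2]; split.
  rewrite (_ : (fun t => _) = (fun t => complex.Re (f t)) \+ (fun t => complex.Re (g t))).
    by rewrite Re_add; apply: is_deriveD.
  by apply/funext => t; rewrite Re_add.
rewrite (_ : (fun t => _) = (fun t => complex.Im (f t)) \+ (fun t => complex.Im (g t))).
  by rewrite Im_add; apply: is_deriveD.
by apply/funext => t; rewrite Im_add.
Qed.

Lemma is_deriveCM (x : R) (f g : R -> C) df dg :
  is_deriveC x f df -> is_deriveC x g dg ->
  is_deriveC x (fun t => f t * g t) (f x * dg + df * g x).
Proof.
move=> [f1 f2] [g1 g2]; split.
  rewrite (_ : (fun t => _) =
    (fun t => complex.Re (f t)) * (fun t => complex.Re (g t)) -
    (fun t => complex.Im (f t)) * (fun t => complex.Im (g t))).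
    apply: is_derive_eq (is_deriveB (is_deriveM f1 g1) (is_deriveM f2 g2)) _.
    by rewrite Re_add !Re_mul /GRing.scale /=; ring.
  by apply/funext => t; rewrite Re_mul.
rewrite (_ : (fun t => _) =
    (fun t => complex.Re (f t)) * (fun t => complex.Im (g t)) +
    (fun t => complex.Im (f t)) * (fun t => complex.Re (g t))).
  apply: is_derive_eq (is_deriveD (is_deriveM f1 g2) (is_deriveM f2 g1)) _.
  by rewrite Im_add !Im_mul /GRing.scale /=; ring.
by apply/funext => t; rewrite Im_mul.
Qed.

Lemma is_deriveC_cst (x : R) (c : C) : is_deriveC x (fun=> c) 0.
Proof. by split; apply: is_derive_cst. Qed.

Lemma is_deriveCZ (x : R) (c : C) (f : R -> C) df :
  is_deriveC x f df -> is_deriveC x (fun t => c * f t) (c * df).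
Proof.
move=> h; have := is_deriveCM (is_deriveC_cst x c) h.
by rewrite mul0r addr0.
Qed.

Lemma is_deriveC_eq (x : R) (f : R -> C) df dg :
  is_deriveC x f df -> df = dg -> is_deriveC x f dg.
Proof. by move=> h <-. Qed.

Lemma is_deriveC_cexp (x : R) z :
  is_deriveC x (fun t => cexp (z * t%:C)) (z * cexp (z * x%:C)).
Proof.
pose r := complex.Re z; pose s := complex.Im z.
have hr : is_derive x (1 : R) (fun t : R => r * t) r.
  by apply: is_derive_eq; rewrite /GRing.scale /=; ring.
have hs : is_derive x (1 : R) (fun t : R => s * t) s.
  by apply: is_derive_eq; rewrite /GRing.scale /=; ring.
have he := is_derive1_comp (@is_derive_expR R (r * x)) hr.
have hc := is_derive1_comp (@is_derive_cos R (s * x)) hs.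
have hn := is_derive1_comp (@is_derive_sin R (s * x)) hs.
split.
  rewrite (_ : (fun t => _) = (@expR R \o *%R r) * (@cos R \o *%R s)).
    apply: is_derive_eq; rewrite /GRing.scale /= Re_mul /cexp !Re_mk !Im_mk (Re_mul z) (Im_mul z) /=.
    by rewrite -/r -/s !mulr0 subr0 add0r; ring.
  by apply/funext => t; rewrite /cexp /= Re_mul Im_mul /= !mulr0 subr0 add0r.
rewrite (_ : (fun t => _) = (@expR R \o *%R r) * (@sin R \o *%R s)).
  apply: is_derive_eq; rewrite /GRing.scale /= Im_mul /cexp !Re_mk !Im_mk (Re_mul z) (Im_mul z) /=.
  by rewrite -/r -/s !mulr0 subr0 add0r; ring.
by apply/funext => t; rewrite /cexp /= Re_mul Im_mul /= !mulr0 subr0 add0r.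
Qed.

End ComplexFacts.

(** * Primitives and the equation [G' = z G + f] *)

Section Primitive.
Context {R : realType}.
Local Notation C := (R[i]).
Local Notation mu := (@lebesgue_measure R).

Lemma nondecreasing_is_derive (F h : R -> R) (a b : R) : a <= b ->
  (forall x, x \in `[a, b] -> is_derive x (1 : R) F (h x)) ->
  (forall x, x \in `[a, b] -> 0 <= h x) -> F a <= F b.
Proof.
move=> ab dF h0.
have cF : {within `[a, b], continuous F}.
  by apply: derivable_within_continuous => x xab; case: (dF x xab).
have dF' x : x \in `]a, b[ -> is_derive x (1 : R) F (h x).
  by move=> xab; apply: dF; apply: subset_itv_oo_cc.
have [c cab E] := MVT_segment ab dF' cF.
by rewrite -subr_ge0 E mulr_ge0 ?h0 ?subr_ge0.
Qed.

(** An integral with fixed lower end [- n] is a primitive only to the right of [- n]; subtracting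
    the value at 0 makes these integrals agree, so they glue to a primitive on the whole line. *)
Lemma continuous_primitive (f : R -> R) : continuous f ->
  exists F : R -> R, F 0 = 0 /\ forall x, is_derive x (1 : R) F (f x).
Proof.
move=> cf.
have intf a b : mu.-integrable `[a, b] (EFin \o f).
  apply: continuous_compact_integrable; first exact: segment_compact.
  exact: continuous_subspaceT.
pose P n x := Rintegral mu `[(- n%:R), x] f.
have P_indep (n m : nat) x : (n <= m)%N -> - n%:R <= x -> 
    P m x - P m 0 = P n x - P n 0.
  move=> nm nx.
  have n0 : (- n%:R : R) <= 0 by rewrite oppr_le0.
  have nm' : (- m%:R : R) <= - n%:R by rewrite lerN2 ler_nat.
  suff H y : - n%:R <= y -> P m y = P m (- n%:R) + P n y.
    by rewrite (H x nx) (H 0 n0); ring.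
  move=> ny; rewrite /P.
  have := @Rintegral_itvB R f (BLeft (- m%:R)) (BRight y) (- n%:R) (intf _ _).
  rewrite !bnd_simp => /(_ nm' ny).
  rewrite (Rintegral_itv_obnd_cbnd (b := BRight y)); last first.
    by apply: integrableS (intf (- n%:R) y) => //; apply: subset_itvr; rewrite bnd_simp.
  by move=> <-; ring.
pose N (x : R) := (Num.truncn `|x| + 2)%N.
have NP x : `|x| + 1 <= (N x)%:R.
  rewrite /N natrD; have := truncnS_gt `|x|; rewrite -natr1; lra.
exists (fun x => P (N x) x - P (N x) 0); split; first by rewrite subrr.
move=> x.
(* One lower end that serves every [y] within distance 1 of [x]. *)
pose M := (N x + 1)%N.
have Mx : `|x| + 2 <= M%:R by rewrite /M natrD; have := NP x; lra.
have dP : is_derive x (1 : R) (P M) (f x).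
  have xM : - M%:R < x by have := lerNnormlW (lexx `|x|); lra.
  have x1 : x < x + 1 by rewrite ltrDl.
  have [] := @continuous_FTC1_closed R f (- M%:R) x (x + 1) x1 (intf _ _) xM (cf x).
  by move=> d E; apply: DeriveDef; [exact: d|rewrite -derive1E; exact: E].
apply: (@near_eq_is_derive _ _ _ (fun y => P M y - P M 0)).
  near=> y.
  have yx : `|x - y| < 1 by near: y; exact: (nbhsx_ballx x 1 ltr01).
  have yn : `|y| <= `|x| + 1.
    have := ler_normB x (x - y); rewrite opprB addrCA subrr addr0; lra.
  have /andP[y1 y2] : (- (N y)%:R <= y) && (- M%:R <= y).
    have h1 := lerNnormlW (lexx `|y|); have h2 := NP y.
    by apply/andP; split; lra.
  rewrite -(P_indep _ _ _ (leq_maxl (N y) M) y1).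
  by rewrite (P_indep _ _ _ (leq_maxr (N y) M) y2).
by apply: is_derive_eq (is_deriveB dP (is_derive_cst _ _ _)) _; rewrite subr0.
Unshelve. all: by end_near. Qed.


Definition ccont (f : R -> C) : Prop :=
  continuous (fun x => complex.Re (f x)) /\
  continuous (fun x => complex.Im (f x)).

Lemma is_deriveC_ccont (F f : R -> C) :
  (forall x, is_deriveC x F (f x)) -> ccont F.
Proof.
move=> dF; split => x; have [[d1 _] [d2 _]] := dF x;
  apply: differentiable_continuous; apply/derivable1_diffP; [exact: d1|exact: d2].
Qed.

Lemma ccontD (f g : R -> C) : ccont f -> ccont g -> ccont (fun x => f x + g x).
Proof.
move=> [f1 f2] [g1 g2]; split => x.
  under eq_fun do rewrite Re_add.
  by apply: cvgD; [exact: f1|exact: g1].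
under eq_fun do rewrite Im_add.
by apply: cvgD; [exact: f2|exact: g2].
Qed.

Lemma ccontM (f g : R -> C) : ccont f -> ccont g -> ccont (fun x => f x * g x).
Proof.
move=> [f1 f2] [g1 g2]; split => x.
  under eq_fun do rewrite Re_mul.
  apply: cvgB; apply: cvgM; by [exact: f1|exact: g1|exact: f2|exact: g2].
under eq_fun do rewrite Im_mul.
apply: cvgD; apply: cvgM; by [exact: f1|exact: g1|exact: f2|exact: g2].
Qed.

Lemma ccont_cexp (z : C) : ccont (fun x => cexp (z * x%:C)).
Proof. by apply: is_deriveC_ccont => x; exact: is_deriveC_cexp. Qed.

Lemma ccont_cst (c : C) : ccont (fun=> c).
Proof. by split => x; exact: cvg_cst. Qed.

Lemma ccontZ (c : C) (f : R -> C) : ccont f -> ccont (fun x => c * f x).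
Proof. exact/ccontM/ccont_cst. Qed.

Lemma is_deriveC_0_is_cst (F : R -> C) :
  (forall x, is_deriveC x F 0) -> forall x y, F x = F y.
Proof.
move=> dF x y; apply: complex_eq.
  by apply: (@is_derive_0_is_cst R (fun x => complex.Re (F x))) => t; case: (dF t).
by apply: (@is_derive_0_is_cst R (fun x => complex.Im (F x))) => t; case: (dF t).
Qed.

Lemma ccont_primitive (f : R -> C) : ccont f ->
  exists F : R -> C, F 0 = 0 /\ forall x, is_deriveC x F (f x).
Proof.
move=> [c1 c2]; have [F [F0 dF]] := continuous_primitive c1.
have [G [G0 dG]] := continuous_primitive c2.
exists (fun x => F x +i* G x); split => [|x]; first by rewrite F0 G0.
by split; [exact: dF|exact: dG].
Qed.

(* [duhamel z f] is the solution of [G' = z G + f], [G 0 = 0]. *)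
Definition duhamel (z : C) (f : R -> C) : R -> C :=
  xget (fun=> 0) [set G | G 0 = 0 /\ forall x, is_deriveC x G (z * G x + f x)].

Lemma cexpNMK (z : C) (x : R) : cexp (- z * x%:C) * cexp (z * x%:C) = 1.
Proof. by rewrite -cexpD mulNr addNr cexp0. Qed.

Lemma duhamelP (z : C) (f : R -> C) : ccont f ->
  duhamel z f 0 = 0 /\
  forall x, is_deriveC x (duhamel z f) (z * duhamel z f x + f x).
Proof.
move=> cf.
have [F [F0 dF]] := ccont_primitive (ccontM (ccont_cexp (- z)) cf).
pose G x := cexp (z * x%:C) * F x.
apply: (@xgetPex _ (fun=> 0)
  [set G | G 0 = 0 /\ forall x, is_deriveC x G (z * G x + f x)]).
exists G; split; first by rewrite /G F0 mulr0.
move=> x; apply: is_deriveC_eq (is_deriveCM (is_deriveC_cexp x z) (dF x)) _.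
rewrite /G mulrA (mulrC (cexp (z * _)) (cexp _)) cexpNMK mul1r; ring.
Qed.

(** The integrating factor [e^(- z x)] turns the difference of two solutions into a function with
    zero derivative. The identities for [duhamel] below all follow this way: a candidate is
    exhibited and checked against the equation. *)
Lemma duhamel_unique (z : C) (f G : R -> C) : ccont f ->
  G 0 = 0 -> (forall x, is_deriveC x G (z * G x + f x)) -> G = duhamel z f.
Proof.
move=> cf G0 dG; have [H0 dH] := duhamelP z cf.
pose U x := cexp (- z * x%:C) * (G x + -1 * duhamel z f x).
have U0 x : U x = 0.
  rewrite (_ : 0 = U 0); last by rewrite /U G0 H0 add0r !mulr0.
  apply: is_deriveC_0_is_cst => {}x.
  have h1 := is_deriveCD (dG x) (is_deriveCZ (-1) (dH x)).
  apply: is_deriveC_eq (is_deriveCM (is_deriveC_cexp x (- z)) h1) _.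
  ring.
apply/funext => x; apply/eqP; rewrite -subr_eq0; apply/eqP.
have := congr1 (fun c => cexp (z * x%:C) * c) (U0 x).
by rewrite /U mulrA mulr0 (mulrC (cexp (z * _)) (cexp _)) cexpNMK mul1r mulN1r.
Qed.

Lemma ccont_duhamel (z : C) (f : R -> C) : ccont f -> ccont (duhamel z f).
Proof. by move=> cf; have [_ /is_deriveC_ccont] := duhamelP z cf. Qed.

Lemma duhamel_linear (z c : C) (f g : R -> C) : ccont f -> ccont g ->
  duhamel z (fun x => f x + c * g x) =
  (fun x => duhamel z f x + c * duhamel z g x).
Proof.
move=> cf cg; have [f0 df] := duhamelP z cf; have [g0 dg] := duhamelP z cg.
apply/esym/duhamel_unique; first exact/ccontD/ccontZ.
  by rewrite f0 g0 mulr0 addr0.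
move=> x; apply: is_deriveC_eq (is_deriveCD (df x) (is_deriveCZ c (dg x))) _.
ring.
Qed.

(** Solving [G' = z G + f] for an exponential [f] produces the divided difference of [w |-> e^(w x)]
    at [w] and [z]. The product form stays valid at [w = z]. *)
Lemma duhamel_cexp (z w : C) x :
  (w - z) * duhamel z (fun x => cexp (w * x%:C)) x =
  cexp (w * x%:C) - cexp (z * x%:C).
Proof.
have [->|wz] := eqVneq w z; first by rewrite !subrr mul0r.
have wz' : w - z != 0 by rewrite subr_eq0.
pose G x := (w - z)^-1 * (cexp (w * x%:C) + -1 * cexp (z * x%:C)).
rewrite -(@duhamel_unique z (fun x => cexp (w * x%:C)) G).
- by rewrite /G mulrA divff // mul1r mulN1r.
- exact: ccont_cexp.
- by rewrite /G (_ : 0%:C = 0) // !mulr0 mulN1r subrr mulr0.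
- move=> y; apply: is_deriveC_eq (is_deriveCZ _ (is_deriveCD (is_deriveC_cexp _ _)
    (is_deriveCZ _ (is_deriveC_cexp _ _)))) _.
  by rewrite /G; field.
Qed.

(* Projecting on the direction of [F x] reduces the mean value inequality to the
   real case. *)
Lemma normc_primitive_le (F f : R -> C) (x M : R) (k : nat) : 0 <= x -> 0 <= M ->
  (forall t, t \in `[0, x] -> is_deriveC t F (f t)) -> F 0 = 0 ->
  (forall t, t \in `[0, x] -> Normc.normc (f t) <= M * (t ^+ k / k`!%:R)) ->
  Normc.normc (F x) <= M * (x ^+ k.+1 / k.+1`!%:R).
Proof.
move=> x0 M0 dF F0 fM.
pose N := Normc.normc (F x).
have [n0|n0] := eqVneq N 0.
  by rewrite -/N n0 mulr_ge0 // divr_ge0 ?exprn_ge0.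
have N0 : 0 < N by rewrite lt_neqAle eq_sym n0 normc_ge0.
pose a := complex.Re (F x); pose b := complex.Im (F x).
have N2 : N ^+ 2 = a ^+ 2 + b ^+ 2.
  by rewrite /N normc_sqrt sqr_sqrtr // addr_ge0 ?sqr_ge0.
have CS t : a * complex.Re (f t) + b * complex.Im (f t) <= N * Normc.normc (f t).
  have := normc_Re ((a +i* (- b)) * f t); rewrite Normc.normcM Re_mul /= => h.
  have E : Num.sqrt (a ^+ 2 + (- b) ^+ 2) = N by rewrite sqrrN /N normc_sqrt.
  rewrite E in h; apply: le_trans h; rewrite mulNr opprK.
  exact: ler_norm.
pose H t := N * (M * (t ^+ k.+1 / k.+1`!%:R)) -
  (a * complex.Re (F t) + b * complex.Im (F t)).
pose dH t := N * (M * (t ^+ k / k`!%:R)) -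
  (a * complex.Re (f t) + b * complex.Im (f t)).
have : H 0 <= H x.
  apply: (nondecreasing_is_derive (h := dH) x0) => t tx.
    have [d1 d2] := dF t tx.
    have dpow : is_derive t (1 : R) (fun y : R => y ^+ k.+1) (k.+1%:R * t ^+ k).
      rewrite (_ : (fun y => _) = (@id R) ^+ k.+1).
        by apply: is_derive_eq; rewrite /GRing.scale /= mulr1.
      by apply/funext => y; rewrite exprfctE.
    rewrite (_ : H = (N * M / k.+1`!%:R) *: (fun y : R => y ^+ k.+1) -
       (a *: (fun t => complex.Re (F t)) + b *: (fun t => complex.Im (F t)))); last first.
      by apply/funext => y; rewrite /H /= !fctE /GRing.scale /=; ring.
    apply: is_derive_eq (is_deriveB (is_deriveZ _ dpow)
      (is_deriveD (is_deriveZ a d1) (is_deriveZ b d2))) _.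
    rewrite /dH factS natrM /GRing.scale /= invfM.
    have k0 : (k`!%:R : R) != 0 by rewrite pnatr_eq0 -lt0n fact_gt0.
    have k1 : (k.+1%:R : R) != 0 by rewrite pnatr_eq0.
    congr (_ - _).
    move: k0 k1; move: (k`!%:R : R) (k.+1%:R : R) (t ^+ k) => u v y u0 v0.
    by field; rewrite u0 v0.
  by rewrite /dH subr_ge0 (le_trans (CS t)) // ler_wpM2l ?fM // ltW.
have -> : H 0 = 0.
  rewrite /H F0 expr0n /=; change (complex.Re (0 : C)) with (0 : R).
  by change (complex.Im (0 : C)) with (0 : R); ring.
rewrite /H subr_ge0 -/a -/b.
by rewrite -!expr2 -N2 expr2 ler_pM2l.
Qed.

(** The primitive of [e^(- z t) f(t)] gains one power of [t] and one factor of the factorial. As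
    [Re z <= h], the exponential weights on [[0, x]] are at most [e^((h - Re z) x)], and multiplying
    back by [e^(z x)] leaves [e^(h x)]. *)
Lemma duhamel_bound_ge0 (z : C) (f : R -> C) (h A x : R) (k : nat) :
  ccont f -> 0 <= A -> complex.Re z <= h ->
  (forall t, Normc.normc (f t) <= A * expR (h * `|t|) * (`|t| ^+ k / k`!%:R)) ->
  0 <= x ->
  Normc.normc (duhamel z f x) <=
    A * expR (h * x) * (x ^+ k.+1 / k.+1`!%:R).
Proof.
move=> cf A0 zh fA x0; have [D0 dD] := duhamelP z cf.
pose F t := cexp (- z * t%:C) * duhamel z f t.
have dF t : is_deriveC t F (cexp (- z * t%:C) * f t).
  apply: is_deriveC_eq (is_deriveCM (is_deriveC_cexp t (- z)) (dD t)) _.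
  ring.
have := @normc_primitive_le F (fun t => cexp (- z * t%:C) * f t) x
  (A * expR ((h - complex.Re z) * x)) k x0.
rewrite mulr_ge0 ?expR_ge0 // => /(_ isT (fun t _ => dF t)).
rewrite /F D0 mulr0 => /(_ erefl) H.
have E : duhamel z f x = cexp (z * x%:C) * (cexp (- z * x%:C) * duhamel z f x).
  by rewrite mulrA (mulrC (cexp (z * _))) cexpNMK mul1r.
rewrite E Normc.normcM normc_cexp Re_mul /= mulr0 subr0.
have {}H : Normc.normc (cexp (- z * x%:C) * duhamel z f x) <=
   A * expR ((h - complex.Re z) * x) * (x ^+ k.+1 / k.+1`!%:R).
  apply: H => t; rewrite in_itv /= => /andP[t0 tx].
  rewrite Normc.normcM normc_cexp Re_mul Re_opp Im_opp /= mulr0 subr0 mulNr.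
  have := fA t; rewrite (ger0_norm t0) => ft.
  apply: (le_trans (ler_wpM2l (expR_ge0 _) ft)).
  rewrite mulrA; apply: ler_wpM2r; first by rewrite divr_ge0 ?exprn_ge0.
  rewrite mulrCA; apply: ler_wpM2l => //.
  by rewrite -expRD ler_expR -mulNr -mulrDl addrC ler_wpM2l // subr_ge0.
apply: (le_trans (ler_wpM2l (expR_ge0 _) H)).
rewrite (_ : h * x = complex.Re z * x + (h - complex.Re z) * x); last by ring.
by rewrite expRD le_eqVlt; apply/orP; left; apply/eqP; ring.
Qed.

Lemma ccont_reflect (f : R -> C) : ccont f -> ccont (fun t => f (- t)).
Proof.
move=> [f1 f2]; split => x.
  change (continuous_at x ((fun t => complex.Re (f t)) \o -%R)).
  by apply: continuous_comp; [exact: opp_continuous|exact: f1].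
change (continuous_at x ((fun t => complex.Im (f t)) \o -%R)).
by apply: continuous_comp; [exact: opp_continuous|exact: f2].
Qed.

Lemma is_deriveC_reflect (x : R) (f : R -> C) df : is_deriveC (- x) f df ->
  is_deriveC x (fun t => f (- t)) (-1 * df).
Proof.
have dN : is_derive x (1 : R) (fun t : R => - t) (-1) by exact: is_deriveN.
move=> [d1 d2]; split.
  apply: is_derive_eq (is_derive1_comp d1 dN) _.
  by rewrite Re_mul /=; ring.
apply: is_derive_eq (is_derive1_comp d2 dN) _.
by rewrite Im_mul /=; ring.
Qed.

(** Reversing the variable exchanges [z] and [- z] and carries the estimate over to negative [x];
    this is why [duhamel_bound] asks for a bound on [|Re z|]. *)
Lemma duhamel_reflect (z : C) (f : R -> C) (x : R) : ccont f ->
  duhamel z f (- x) = duhamel (- z) (fun t => -1 * f (- t)) x.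
Proof.
move=> cf; have [D0 dD] := duhamelP z cf.
rewrite -(@duhamel_unique (- z) _ (fun x => duhamel z f (- x))) //.
- exact/ccontZ/ccont_reflect.
- by rewrite oppr0.
- move=> y; apply: is_deriveC_eq (is_deriveC_reflect (dD (- y))) _; ring.
Qed.

Lemma duhamel_bound (z : C) (f : R -> C) (h A : R) (k : nat) :
  ccont f -> 0 <= A -> `|complex.Re z| <= h ->
  (forall t, Normc.normc (f t) <= A * expR (h * `|t|) * (`|t| ^+ k / k`!%:R)) ->
  forall x, Normc.normc (duhamel z f x) <=
    A * expR (h * `|x|) * (`|x| ^+ k.+1 / k.+1`!%:R).
Proof.
move=> cf A0 zh fA x; have [x0|x0] := leP 0 x.
  rewrite (ger0_norm x0); apply: duhamel_bound_ge0 => //.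
  exact: le_trans (ler_norm _) zh.
have nx0 : 0 <= - x by rewrite oppr_ge0 ltW.
rewrite -(opprK x) duhamel_reflect // opprK -normrN (ger0_norm nx0).
apply: duhamel_bound_ge0 => //.
- exact/ccontZ/ccont_reflect.
- by rewrite Re_opp; apply: le_trans zh; rewrite lerNl; exact: lerNnormlW.
- by move=> t; rewrite mulN1r normc_opp; have := fA (- t); rewrite normrN.
Qed.

End Primitive.

(** * Newton interpolation of exponentials *)

Section Interpolation.
Context {R : realType}.
Local Notation C := (R[i]).

Definition expf (w : C) (x : R) : C := cexp (w * x%:C).

Lemma ccont_expf w : ccont (expf w). Proof. exact: ccont_cexp. Qed.

(** Applied to [expf w], this is the divided difference of the entire function [w |-> e^(w x)] at
    [w] and the nodes in [s]. The last node of the list acts first. *)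
Definition duhamels (s : seq C) (f : R -> C) : R -> C :=
  foldr (fun z g => duhamel z g) f s.

Lemma ccont_duhamels s (f : R -> C) : ccont f -> ccont (duhamels s f).
Proof. by move=> cf; elim: s => //= z s; exact: ccont_duhamel. Qed.

Lemma duhamels_linear s (c : C) (f g : R -> C) : ccont f -> ccont g ->
  duhamels s (fun x => f x + c * g x) =
  (fun x => duhamels s f x + c * duhamels s g x).
Proof.
move=> cf cg; elim: s => //= z s ->.
by rewrite duhamel_linear //; exact: ccont_duhamels.
Qed.

(** The remainder estimate of Newton interpolation: each node contributes one power and one factor
    of the factorial. Since [h] bounds real parts only, nodes going to infinity in the imaginary
    direction do no harm. *)
Lemma duhamels_bound s (f : R -> C) (h A : R) (k : nat) :
  ccont f -> 0 <= A -> (forall z, z \in s -> `|complex.Re z| <= h) ->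
  (forall t, Normc.normc (f t) <= A * expR (h * `|t|) * (`|t| ^+ k / k`!%:R)) ->
  forall x, Normc.normc (duhamels s f x) <=
    A * expR (h * `|x|) * (`|x| ^+ (size s + k) / (size s + k)`!%:R).
Proof.
move=> cf A0 + fA; elim: s => //= z s IH hs x.
rewrite addSn; apply: duhamel_bound => //.
- exact: ccont_duhamels.
- by apply: hs; rewrite mem_head.
- by apply: IH => w ws; apply: hs; rewrite inE ws orbT.
Qed.

Lemma expf_bound w (h : R) : `|complex.Re w| <= h ->
  forall t, Normc.normc (expf w t) <= 1 * expR (h * `|t|) * (`|t| ^+ 0 / 0`!%:R).
Proof.
move=> wh t; rewrite expr0 fact0 divr1 mulr1 mul1r normc_cexp ler_expR.
rewrite Re_mul /= mulr0 subr0; apply: le_trans (ler_norm _) _.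
by rewrite normrM ler_wpM2r.
Qed.

(** The bound is stated for every majorant [M], which avoids a supremum norm. [L] accepts all
    functions but is constrained on continuous ones only, and is controlled by their values on
    [[-b, b]]. *)
Record bounded_functional (b : R) (L : (R -> C) -> C) : Prop := BoundedFunctional {
  bf_linear : forall (c : C) (f g : R -> C), ccont f -> ccont g ->
    L (fun x => f x + c * g x) = L f + c * L g;
  bf_bound : exists2 K : R, 0 <= K & forall (f : R -> C) (M : R), ccont f ->
    (forall x, `|x| <= b -> Normc.normc (f x) <= M) -> Normc.normc (L f) <= K * M }.

(* A zero of multiplicity at least [m], the factorization being only needed with a
   locally bounded cofactor. *)
Definition vanishes (D : C -> C) (z : C) (m : nat) : Prop :=
  exists g : C -> C, (forall w, D w = (w - z) ^+ m * g w) /\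
    exists d B : R, 0 < d /\
      forall w, Normc.normc (w - z) < d -> Normc.normc (g w) <= B.

Lemma bounded_functional0 b L : bounded_functional b L -> L (fun=> 0) = 0.
Proof.
move=> HL; have := bf_linear HL (-1) (@ccont_cst R 0) (@ccont_cst R 0).
by under eq_fun do rewrite mulr0 addr0; rewrite mulN1r subrr.
Qed.

(** The nodes different from [z] contribute a factor that stays away from 0 near [z], so it can be
    divided out in a limit. *)
Lemma prod_lower_bound (z : C) (s : seq C) : z \notin s ->
  exists q d : R, [/\ 0 < q, 0 < d & forall w, Normc.normc (w - z) < d ->
    q <= Normc.normc (\prod_(y <- s) (w - y))].
Proof.
elim: s => [_|y s IH].
  by exists 1, 1; split => // w _; rewrite big_nil Normc.normc1.
rewrite inE negb_or => /andP[zy /IH[q [d [q0 d0 H]]]].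
pose e := Normc.normc (z - y).
have e0 : 0 < e.
  rewrite lt_neqAle normc_ge0 andbT eq_sym; apply: contraNneq zy => /Normc.eq0_normc /eqP.
  by rewrite subr_eq0.
exists (e / 2 * q), (Num.min d (e / 2)); split.
- by rewrite mulr_gt0 // divr_gt0.
- by rewrite lt_min d0 divr_gt0.
move=> w; rewrite lt_min => /andP[wd we].
rewrite big_cons Normc.normcM ler_pM ?H ?ltW // ?divr_gt0 //.
have := normcD (w - y) (z - w).
rewrite addrC addrA subrK -/e -(normc_opp (z - w)) opprB; lra.
Qed.

Variables (b : R) (L : (R -> C) -> C) (zs : nat -> C).
Hypothesis (b0 : 0 <= b) (HL : bounded_functional b L).

Let D w := L (expf w).
Let s m := map zs (iota 0 m).
(** The divided difference of [D] at [w] and the first [m] nodes. *)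
Let Phi m w := L (duhamels (s m) (expf w)).

Let sS m : s m.+1 = rcons (s m) (zs m).
Proof. by rewrite /s -addn1 iotaD map_cat cats1. Qed.

(** [duhamel_cexp] passes through the linear maps [duhamels u] and [L]. *)
Lemma functional_divided_difference (u : seq C) (w z : C) :
  (w - z) * L (duhamels u (duhamel z (expf w))) =
  L (duhamels u (expf w)) - L (duhamels u (expf z)).
Proof.
have c1 := ccont_duhamels u (ccont_expf w).
have c2 := ccont_duhamels u (ccont_expf z).
have c3 := ccont_duhamels u (ccont_duhamel z (ccont_expf w)).
have c0 := ccont_duhamels u (@ccont_cst R 0).
have E1 : duhamels u (fun=> 0) = fun=> 0.
  have := duhamels_linear u (-1) c0 c0.
  under eq_fun do rewrite mulN1r subrr.
  by under [RHS]eq_fun do rewrite mulN1r subrr.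
have E : duhamels u (fun x => 0 + (w - z) * duhamel z (expf w) x) =
    duhamels u (fun x => expf w x + -1 * expf z x).
  by congr duhamels; apply/funext => x; rewrite add0r duhamel_cexp mulN1r.
have cz := ccont_expf z; have cw := ccont_expf w.
rewrite !duhamels_linear ?E1 // in E; try exact: ccont_cst; try exact: ccont_duhamel.
have := congr1 L E; rewrite !(bf_linear HL) //; last exact: ccont_cst.
by rewrite (bounded_functional0 HL) add0r mulN1r.
Qed.

Let PhiS m w : (w - zs m) * Phi m.+1 w = Phi m w - Phi m (zs m).
Proof.
by rewrite /Phi sS /duhamels foldr_rcons -functional_divided_difference.
Qed.

(** The increment is [w - z] times the divided difference with the extra node [z], which
    [duhamels_bound] controls uniformly for [w] near [z]. *)
Lemma functional_lipschitz (u : seq C) (z : C) : exists2 K : R, 0 <= K &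
  forall w, Normc.normc (w - z) <= 1 ->
  Normc.normc (L (duhamels u (expf w)) - L (duhamels u (expf z))) <=
    K * Normc.normc (w - z).
Proof.
have [K K0 LK] := bf_bound HL.
pose h := \sum_(y <- u) Normc.normc y + Normc.normc z + 1.
have S0 (v : seq C) : 0 <= \sum_(y <- v) Normc.normc y.
  by apply: sumr_ge0 => y _; exact: normc_ge0.
have hu : forall y, y \in rcons u z -> `|complex.Re y| <= h.
  move=> y; rewrite mem_rcons inE => /orP[/eqP ->|yu].
    by apply: le_trans (normc_Re z) _; rewrite /h; have := S0 u; lra.
  apply: le_trans (normc_Re y) _; rewrite /h (big_rem y yu) /=.
  by have := S0 (rem y u); have := normc_ge0 z; lra.
pose n := size (rcons u z).
pose M : R := expR (h * b) * (b ^+ n / n`!%:R).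
have M0 : 0 <= M by rewrite mulr_ge0 ?expR_ge0 // divr_ge0 ?exprn_ge0.
have h0 : 0 <= h by rewrite /h !addr_ge0 ?normc_ge0.
exists (K * M); first by rewrite mulr_ge0.
move=> w wz; rewrite -functional_divided_difference Normc.normcM mulrC.
apply: ler_wpM2r; first exact: normc_ge0.
apply: LK; first exact/ccont_duhamels/ccont_duhamel/ccont_expf.
move=> x xb.
have := @duhamels_bound (rcons u z) (expf w) h 1 0 (ccont_expf w) ler01 hu _ x.
rewrite addn0 /duhamels foldr_rcons mul1r -/n => H.
apply: le_trans (H _) _.
  apply: expf_bound; apply: le_trans (normc_Re w) _.
  have := normcD (w - z) z; rewrite subrK /h; have := S0 u; lra.
apply: ler_pM; rewrite ?expR_ge0 ?divr_ge0 ?exprn_ge0 //.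
  by rewrite ler_expR ler_wpM2l.
by apply: ler_wpM2r => //; rewrite lerXn2r // nnegrE.
Qed.

(** The count runs over the nodes up to [n]: a value that occurs again later needs a higher order
    only at that later index. *)
Hypothesis Dzs : forall n, exists2 m,
  (count (fun j => zs j == zs n) (iota 0 n.+1) <= m)%N & vanishes D (zs n) m.

Let prod_split (z : C) (v : seq C) (w : C) : \prod_(y <- v) (w - y) =
  (w - z) ^+ count (pred1 z) v * \prod_(y <- [seq y <- v | y != z]) (w - y).
Proof.
elim: v => [|y v IH]; first by rewrite !big_nil expr0 mulr1.
rewrite big_cons IH /=; have [->|yz] := eqVneq y z.
  by rewrite add1n exprS mulrA.
by rewrite add0n big_cons mulrCA.
Qed.

(** Newton's formula in which every coefficient [Phi j (zs j)] is zero, so that only the remainder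
    survives. Dividing [D] by the factors of the earlier nodes shows that [Phi m] tends to 0 at
    [zs m], repeated nodes being covered by the multiplicity; the Lipschitz bound identifies this
    limit with the value. *)
Lemma newton_interpolation m w : \prod_(y <- s m) (w - y) * Phi m w = D w.
Proof.
elim: m w => [|m IH] w; first by rewrite /s /= big_nil mul1r.
rewrite sS -cats1 big_cat /= big_seq1 -mulrA PhiS mulrBr IH.
suff -> : Phi m (zs m) = 0 by rewrite mulr0 subr0.
set z := zs m.
have [M cM [g [Dg [d [B [d0 gB]]]]]] := Dzs m.
(* The count in [Dzs] includes the node [zs m] itself, hence the strict inequality. *)
have : (count (pred1 z) (s m) < M)%N.
  have E : iota 0 m.+1 = iota 0 m ++ [:: m] by rewrite -addn1 iotaD.
  apply: leq_trans cM; rewrite E count_cat /=.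
  by rewrite eqxx addn0 addn1 ltnS /s count_map.
set r := count _ _ => rM.
have [|q [d' [q0 d'0 qP]]] := @prod_lower_bound z [seq y <- s m | y != z].
  by rewrite mem_filter eqxx.
have [K K0 lipK] := functional_lipschitz (s m) z.
have E (e : R) : 0 < e -> e < d -> e < d' -> e <= 1 ->
    Normc.normc (Phi m z) <= (`|B| / q + K) * e.
  move=> e0 ed ed' e1.
  pose w1 := z + e%:C.
  have w1z : w1 - z = e%:C by rewrite /w1 addrC addKr.
  have nw : Normc.normc (w1 - z) = e by rewrite w1z normc_real gtr0_norm.
  have w1z0 : w1 - z != 0.
    by apply/eqP => H; move: nw; rewrite H Normc.normc0; lra.
  (* After cancelling [(w1 - z)^r] at least one factor [w1 - z] is left on the side of [D], which
     makes [Phi m w1] of order [e]. *)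
  have := IH w1; rewrite Dg (prod_split z) -/r -(subnKC rM) addSn -addnS exprD -!mulrA.
  move/(mulfI (expf_neq0 _ w1z0)) => /(congr1 (@Normc.normc R)).
  rewrite !Normc.normcM => H1.
  have h1 : q * Normc.normc (Phi m w1) <= e * `|B|.
    apply: (@le_trans _ _ (Normc.normc (\prod_(y <- [seq y <- s m | y != z]) (w1 - y)) *
       Normc.normc (Phi m w1))).
      by rewrite ler_wpM2r ?normc_ge0 // qP // nw.
    rewrite H1; apply: ler_pM; rewrite ?normc_ge0 //; last first.
      by apply: le_trans (ler_norm _); apply: gB; rewrite nw.
    rewrite exprS Normc.normcM nw ler_piMr ?(ltW e0) //.
    by rewrite w1z -rmorphXn normc_real normrX gtr0_norm // exprn_ile1 // ltW.
  have h2 := lipK w1; rewrite nw in h2; have {}h2 := h2 e1.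
  have h3 := normcD (Phi m w1) (Phi m z - Phi m w1).
  rewrite addrC subrK -(normc_opp (_ - _)) opprB in h3.
  have h4 : Normc.normc (Phi m w1) <= `|B| / q * e.
    by rewrite mulrAC ler_pdivlMr // mulrC (mulrC `|B|).
  apply: (le_trans h3); rewrite mulrDl lerD //.
apply: Normc.eq0_normc; apply/eqP; rewrite eq_le normc_ge0 andbT.
apply/ler_addgt0Pl => e e0; rewrite addr0.
pose A := `|B| / q + K + 1.
have Bq : 0 <= `|B| / q by rewrite divr_ge0 // ltW.
have A0 : 0 < A by rewrite /A; lra.
pose t := Num.min (Num.min (d / 2) (d' / 2)) (Num.min 1 (e / A)).
have t0 : 0 < t by rewrite !lt_min ltr01 !divr_gt0.
have := E t t0.
have [t1 t2 t3 t4] : [/\ t <= d / 2, t <= d' / 2, t <= 1 & t <= e / A].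
  by rewrite /t; split; rewrite !ge_min lexx ?orbT.
rewrite ler_pdivlMr // in t4.
move=> H; apply: le_trans (H _ _ t3) _; try lra.
apply: le_trans t4; rewrite mulrC ler_wpM2l ?ltW // /A; lra.
Qed.

Lemma eq0_of_ratio_bound (c rho : R) (v : nat -> R) (N : nat) :
  0 <= rho -> rho < 1 -> (forall m, c <= v m) ->
  (forall m, (N <= m)%N -> v m.+1 <= rho * v m) -> c <= 0.
Proof.
move=> rho0 rho1 cv vS; rewrite leNgt; apply/negP => c0.
have H k : v (N + k)%N <= v N * rho ^+ k.
  elim: k => [|k IH]; first by rewrite addn0 expr0 mulr1.
  rewrite addnS exprS mulrCA; apply: le_trans (vS _ (leq_addr _ _)) _.
  by rewrite ler_wpM2l.
have G : geometric (v N) rho n @[n --> \oo] --> (0 : R).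
  by apply: cvg_geometric; rewrite ger0_norm.
have [k _ /(_ k (leqnn k))] : \forall n \near \oo, `|geometric (v N) rho n| < c.
  by have := cvgr0_norm_lt _ G; exact.
rewrite /geometric /=; apply/negP; rewrite -leNgt.
by apply: le_trans (ler_norm _); apply: le_trans (cv _) (H k).
Qed.

(* The error factor [b^m / m!] of Newton interpolation beats the product of the
   [|w - z_j| ~ j / 2], j < m, exactly when [b < 2]. *)
Theorem functional_eq0_of_zeros (M : R) : b < 2 ->
  (forall n, Normc.normc (zs n) <= n%:R / 2 + M) ->
  (forall n, `|complex.Re (zs n)| <= M) -> forall w, L (expf w) = 0.
Proof.
move=> b2 zsM ReM w; have [K K0 LK] := bf_bound HL.
pose A := Normc.normc w + M.
pose h := `|complex.Re w| + M.
have M0 : 0 <= M by apply: le_trans (ReM 0%N).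
have A0 : 0 <= A by rewrite addr_ge0 ?normc_ge0.
have h0 : 0 <= h by rewrite addr_ge0.
pose v m := K * expR (h * b) * \prod_(j < m) ((j%:R / 2 + A) * (b / j.+1%:R)).
have v0 m : 0 <= v m.
  rewrite /v !mulr_ge0 ?expR_ge0 // prodr_ge0 // => j _.
  apply: mulr_ge0; last exact: divr_ge0.
  by apply: addr_ge0 => //; exact: divr_ge0.
have Dv m : Normc.normc (D w) <= v m.
  rewrite -(newton_interpolation m w) Normc.normcM normc_prod.
  have P1 : \prod_(y <- s m) Normc.normc (w - y) <= \prod_(j < m) (j%:R / 2 + A).
    rewrite /s big_map -[m in iota 0 m]subn0 -/(index_iota 0 m) big_mkord.
    apply: ler_prod => j _; rewrite normc_ge0 /=.
    apply: le_trans (normcD _ _) _; rewrite normc_opp /A.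
    by have := zsM j; lra.
  have P2 : Normc.normc (Phi m w) <= K * (expR (h * b) * (b ^+ m / m`!%:R)).
    apply: LK; first exact/ccont_duhamels/ccont_expf.
    move=> x xb.
    have := @duhamels_bound (s m) (expf w) h 1 0 (ccont_expf w) ler01 _ _ x.
    rewrite size_map size_iota addn0 mul1r => H.
    apply: le_trans (H _ _) _.
    - move=> z /mapP[j _ ->]; apply: le_trans (ReM j) _.
      by rewrite /h lerDr.
    - by apply: expf_bound; rewrite /h lerDl.
    apply: ler_pM; rewrite ?expR_ge0 ?divr_ge0 ?exprn_ge0 //.
      by rewrite ler_expR ler_wpM2l.
    by apply: ler_wpM2r => //; rewrite lerXn2r // nnegrE.
  have -> : v m = \prod_(j < m) (j%:R / 2 + A) *
      (K * (expR (h * b) * (b ^+ m / m`!%:R))).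
    rewrite /v big_split /= prodf_div big_const_ord iter_mulr_1.
    rewrite (_ : \prod_(j < m) j.+1%:R = m`!%:R); last first.
      by rewrite fact_prod big_add1 /= big_mkord natr_prod.
    ring.
  apply: ler_pM; rewrite ?normc_ge0 //.
  by apply: prodr_ge0 => y _; exact: normc_ge0.
apply: Normc.eq0_normc; apply/eqP; rewrite eq_le normc_ge0 andbT.
(* The midpoint of 1 and [b / 2], the latter being the limit of the ratios [v m.+1 / v m]. *)
pose rho := b / 2 / 2 + 2^-1.
have rho1 : rho < 1 by rewrite /rho; lra.
have rho0 : 0 <= rho by rewrite /rho; have := b0; lra.
(* From this index on [b * A] is absorbed by [(rho - b / 2) * (m + 1)], which brings the ratio below
   [rho]. *)
pose N := Num.truncn (b * A / (rho - b / 2)).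
apply: (@eq0_of_ratio_bound _ rho v N) => // m Nm.
have -> : v m.+1 = (m%:R / 2 + A) * (b / m.+1%:R) * v m.
  by rewrite /v big_ord_recr /=; ring.
rewrite ler_wpM2r //.
have rb : 0 < rho - b / 2 by rewrite /rho; lra.
have : b * A / (rho - b / 2) < m.+1%:R.
  by apply: lt_le_trans (truncnS_gt _) _; rewrite ler_nat ltnS.
rewrite ltr_pdivrMr // => Hm.
rewrite mulrA ler_pdivrMr ?ltr0n // -natr1 in Hm *.
have : 0 <= (m%:R : R) by [].
nra.
Qed.

End Interpolation.

(** * Complex integrals and integral functionals *)

Section ComplexIntegral.
Context {R : realType} d (T : measurableType d).
Variable nu : {measure set T -> \bar R}.
Local Notation C := (R[i]).
Implicit Types (D : set T) (f g : T -> C).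

Definition cmeasurable D f : Prop :=
  measurable_fun D (fun x => complex.Re (f x)) /\
  measurable_fun D (fun x => complex.Im (f x)).

Definition cintegrable D f : Prop :=
  nu.-integrable D (fun x => (complex.Re (f x))%:E) /\
  nu.-integrable D (fun x => (complex.Im (f x))%:E).

Definition cint D f : C :=
  (\int[nu]_(x in D) complex.Re (f x)) +i* (\int[nu]_(x in D) complex.Im (f x)).

Lemma cintegrable_cmeasurable D f : cintegrable D f -> cmeasurable D f.
Proof.
by move=> [/measurable_int/measurable_EFinP h1 /measurable_int/measurable_EFinP h2].
Qed.

Lemma cmeasurableM D f g : cmeasurable D f -> cmeasurable D g ->
  cmeasurable D (fun x => f x * g x).
Proof.
move=> [f1 f2] [g1 g2]; split.
  under eq_fun do rewrite Re_mul.
  by apply: measurable_funB; apply: measurable_funM.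
under eq_fun do rewrite Im_mul.
by apply: measurable_funD; apply: measurable_funM.
Qed.

Lemma cmeasurable_normc D f : measurable D -> cmeasurable D f ->
  measurable_fun D (fun x => Normc.normc (f x)).
Proof.
move=> mD [f1 f2]; under eq_fun do rewrite normc_sqrt.
apply: (measurableT_comp (f := fun y : R => Num.sqrt y)).
  by apply: continuous_measurable_fun => ?; exact: sqrt_continuous.
by apply: measurable_funD; exact: measurable_funX.
Qed.

Variable D : set T.
Hypothesis mD : measurable D.

Lemma cintegrableD f g : cintegrable D f -> cintegrable D g ->
  cintegrable D (fun x => f x + g x).
Proof.
move=> [f1 f2] [g1 g2]; split.
  by under eq_fun do rewrite Re_add EFinD; exact: integrableD.
by under eq_fun do rewrite Im_add EFinD; exact: integrableD.
Qed.

Lemma cintegrableZ c f : cintegrable D f -> cintegrable D (fun x => c * f x).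
Proof.
move=> [f1 f2]; split.
  under eq_fun do rewrite Re_mul EFinB 2!EFinM.
  by apply: integrableB => //; exact: integrableZl.
under eq_fun do rewrite Im_mul EFinD 2!EFinM.
by apply: integrableD => //; exact: integrableZl.
Qed.

Lemma cintD f g : cintegrable D f -> cintegrable D g ->
  cint D (fun x => f x + g x) = cint D f + cint D g.
Proof.
move=> [f1 f2] [g1 g2]; apply: complex_eq; rewrite /cint ?Re_add ?Im_add /=.
  by rewrite -RintegralD //; apply: eq_Rintegral => x _; rewrite Re_add.
by rewrite -RintegralD //; apply: eq_Rintegral => x _; rewrite Im_add.
Qed.

Lemma cintZ c f : cintegrable D f -> cint D (fun x => c * f x) = c * cint D f.
Proof.
move=> [f1 f2]; apply: complex_eq; rewrite /cint ?Re_mul ?Im_mul /=.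
  under eq_Rintegral do rewrite Re_mul.
  rewrite RintegralB ?RintegralZl //=.
  - exact: (integrableZl mD (complex.Re c) f1).
  - exact: (integrableZl mD (complex.Im c) f2).
under eq_Rintegral do rewrite Im_mul.
rewrite RintegralD ?RintegralZl //=.
- exact: (integrableZl mD (complex.Re c) f2).
- exact: (integrableZl mD (complex.Im c) f1).
Qed.

Lemma cintegrable_normc f : cintegrable D f ->
  nu.-integrable D (fun x => (Normc.normc (f x))%:E).
Proof.
move=> fi; have [m1 m2] := cintegrable_cmeasurable fi; have [f1 f2] := fi.
apply: (le_integrable mD _ _ (integrableD mD (integrable_norm f1) (integrable_norm f2))).
  by apply/measurable_EFinP; exact: cmeasurable_normc.
move=> x _ /=; rewrite lee_fin ger0_norm ?normc_ge0 //.
by rewrite ger0_norm ?addr_ge0 // normc_le.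
Qed.

Lemma cintegrable_le f (g : T -> R) : cmeasurable D f ->
  nu.-integrable D (EFin \o g) ->
  (forall x, D x -> Normc.normc (f x) <= g x) -> cintegrable D f.
Proof.
move=> [f1 f2] gi fg; split; apply: (le_integrable mD _ _ gi) => /=.
- exact/measurable_EFinP.
- move=> x /fg h; rewrite lee_fin; apply: le_trans (normc_Re _) _.
  exact: le_trans h (ler_norm _).
- exact/measurable_EFinP.
- move=> x /fg h; rewrite lee_fin; apply: le_trans (normc_Im _) _.
  exact: le_trans h (ler_norm _).
Qed.

(** Real and imaginary parts are estimated separately, whence the factor 2; later only the
    finiteness of the constant matters. *)
Lemma normc_cint_le f (g : T -> R) : cmeasurable D f ->
  nu.-integrable D (EFin \o g) ->
  (forall x, D x -> Normc.normc (f x) <= g x) ->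
  Normc.normc (cint D f) <= 2 * \int[nu]_(x in D) g x.
Proof.
move=> mf gi fg; have [f1 f2] := cintegrable_le mf gi fg.
apply: le_trans (normc_le _) _; rewrite mulr_natl mulr2n /= lerD //.
  apply: le_trans (le_normr_Rintegral mD f1) _.
  apply: le_Rintegral => //; first exact: integrable_norm.
  by move=> x /fg h; exact: le_trans (normc_Re _) h.
apply: le_trans (le_normr_Rintegral mD f2) _.
apply: le_Rintegral => //; first exact: integrable_norm.
by move=> x /fg h; exact: le_trans (normc_Im _) h.
Qed.

(** The bound on [g] is asked only where [f] does not vanish, because phases are controlled only on
    the support of the kernel. *)
Lemma cintegrableM_bounded f g (M : R) : cintegrable D f -> cmeasurable D g ->
  (forall x, D x -> f x != 0 -> Normc.normc (g x) <= M) ->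
  cintegrable D (fun x => f x * g x).
Proof.
move=> fi mg gM.
have fn := integrableZl mD M (cintegrable_normc fi).
apply: (cintegrable_le (g := fun x => M * Normc.normc (f x))) => //.
  exact: cmeasurableM (cintegrable_cmeasurable fi) mg.
move=> x Dx; rewrite Normc.normcM mulrC.
have [->|f0] := eqVneq (f x) 0; first by rewrite Normc.normc0 !mulr0.
by rewrite ler_wpM2r ?normc_ge0 // gM.
Qed.

Lemma dominated_Rintegral (f_ : nat -> T -> R) (f g : T -> R) :
  (forall n, measurable_fun D (f_ n)) -> measurable_fun D f ->
  (forall x, D x -> f_ n x @[n --> \oo] --> f x) ->
  nu.-integrable D (EFin \o g) ->
  (forall n x, D x -> `|f_ n x| <= g x) ->
  \int[nu]_(x in D) f_ n x @[n --> \oo] --> \int[nu]_(x in D) f x.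
Proof.
move=> mf_ mf f_f gi fg.
have fi : nu.-integrable D (EFin \o f).
  apply: (le_integrable mD _ _ gi); first exact/measurable_EFinP.
  move=> x Dx /=; rewrite lee_fin; apply: le_trans (ler_norm _).
  have h : `|f_ n x| @[n --> \oo] --> `|f x| by apply: cvg_norm; exact: f_f.
  rewrite -(cvg_lim _ h) //; apply: limr_le; first by apply/cvg_ex; eexists; exact: h.
  by apply: nearW => n; exact: fg.
apply: fine_cvg; rewrite fineK; last exact: integrable_fin_num.
apply: (dominated_cvg mD (g := EFin \o g)) => //.
- by move=> n; exact/measurable_EFinP.
- by move=> x Dx; apply: cvg_EFin; [exact: nearW|exact: f_f].
Qed.

Lemma eq_cint f g : (forall x, D x -> f x = g x) -> cint D f = cint D g.
Proof.
move=> fg; congr (_ +i* _); apply: eq_Rintegral => x /set_mem Dx; by rewrite fg.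
Qed.

End ComplexIntegral.

(** * Functionals given by a kernel and a phase *)

Section KernelFunctional.
Context {R : realType} d (T : measurableType d).
Variables (nu : {measure set T -> \bar R}) (k : T -> R[i]) (theta : T -> R) (b : R).
Local Notation C := (R[i]).
Hypotheses (ki : cintegrable nu setT k) (mtheta : measurable_fun setT theta).
Hypothesis (thetab : forall x, k x != 0 -> `|theta x| <= b).

(** Integration of [phi] against the image under [theta] of the complex measure with density [k].
    The source space is general so that single and double integrals are treated alike. *)
Definition kernel_functional (phi : R -> C) : C :=
  cint nu setT (fun x => k x * phi (theta x)).

Lemma ccont_cmeasurable (phi : R -> C) : ccont phi ->
  cmeasurable setT (fun x => phi (theta x)).
Proof.
move=> [c1 c2]; split.
  apply: (measurableT_comp (f := fun y => complex.Re (phi y))) => //.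
  exact: continuous_measurable_fun.
apply: (measurableT_comp (f := fun y => complex.Im (phi y))) => //.
exact: continuous_measurable_fun.
Qed.

Lemma ccont_bounded (phi : R -> C) : ccont phi ->
  exists M, forall x, `|x| <= b -> Normc.normc (phi x) <= M.
Proof.
move=> [c1 c2].
have bnd (f : R -> R) : continuous f -> exists M, forall x, `|x| <= b -> `|f x| <= M.
  move=> cf; have : compact (f @` `[- b, b]).
    apply: continuous_compact; first exact: continuous_subspaceT.
    exact: segment_compact.
  move=> /compact_bounded [M [_ HM]]; exists (M + 1) => x xb.
  apply: (HM (M + 1)); first by rewrite ltrDl.
  by exists x => //=; rewrite in_itv /= -ler_norml.
have [M1 H1] := bnd _ c1; have [M2 H2] := bnd _ c2.
exists (M1 + M2) => x xb; apply: le_trans (normc_le _) _.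
by rewrite lerD ?H1 ?H2.
Qed.

Lemma kernel_functional_bounded : bounded_functional b kernel_functional.
Proof.
split.
  move=> c f g cf cg.
  have [Mf Hf] := ccont_bounded cf; have [Mg Hg] := ccont_bounded cg.
  have If := cintegrableM_bounded (@measurableT _ T) ki (ccont_cmeasurable cf)
    (fun x _ kx => Hf _ (thetab kx)).
  have Ig := cintegrableM_bounded (@measurableT _ T) ki (ccont_cmeasurable cg)
    (fun x _ kx => Hg _ (thetab kx)).
  rewrite /kernel_functional -cintZ // -cintD //; last exact: cintegrableZ.
  by apply: eq_cint => x _; ring.
have kn := cintegrable_normc measurableT ki.
exists (2 * \int[nu]_(x in setT) Normc.normc (k x)).
  by rewrite mulr_ge0 // Rintegral_ge0 // => x _; exact: normc_ge0.
move=> f M cf fM.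
rewrite -mulrA -RintegralZr //; apply: normc_cint_le => //.
- exact: cmeasurableM (cintegrable_cmeasurable ki) (ccont_cmeasurable cf).
- have := integrableZl measurableT M kn; apply: eq_integrable => // x _.
  by rewrite /= EFinM muleC.
- move=> x _; rewrite Normc.normcM.
  have [->|k0] := eqVneq (k x) 0; first by rewrite Normc.normc0 !mul0r.
  by rewrite ler_wpM2l ?normc_ge0 // fM // thetab.
Qed.

Lemma kernel_functional_cvg (phi_ : nat -> R -> R) (phi : R -> R) (M : R) :
  (forall n, measurable_fun setT (phi_ n)) -> measurable_fun setT phi ->
  (forall n x, `|x| <= b -> `|phi_ n x| <= M) ->
  (forall x, phi_ n x @[n --> \oo] --> phi x) ->
  complex.Re (kernel_functional (fun x => (phi_ n x)%:C)) @[n --> \oo] -->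
    complex.Re (kernel_functional (fun x => (phi x)%:C)) /\
  complex.Im (kernel_functional (fun x => (phi_ n x)%:C)) @[n --> \oo] -->
    complex.Im (kernel_functional (fun x => (phi x)%:C)).
Proof.
move=> mphi_ mphi phiM phicvg.
have [k1 k2] := cintegrable_cmeasurable ki.
have kn := integrableZl measurableT M (cintegrable_normc measurableT ki).
have mt n : measurable_fun setT (fun x => phi_ n (theta x)).
  exact: measurableT_comp.
have mt' : measurable_fun setT (fun x => phi (theta x)).
  exact: measurableT_comp.
have bnd n x (c : R) : `|c| <= Normc.normc (k x) ->
    `|c * phi_ n (theta x)| <= M * Normc.normc (k x).
  move=> ck; rewrite normrM mulrC.
  have [k0|k0] := eqVneq (k x) 0.
    move: ck; rewrite k0 Normc.normc0 normr_le0 => /eqP ->.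
    by rewrite normr0 !mulr0.
  by rewrite ler_pM // phiM // thetab.
split; rewrite /kernel_functional /cint /=.
- under eq_fun do under eq_Rintegral do rewrite Re_mul /= mulr0 subr0.
  under eq_Rintegral do rewrite Re_mul /= mulr0 subr0.
  apply: (@dominated_Rintegral _ _ _ _ _ _ _ _ (fun x => M * Normc.normc (k x))) => //.
  + by move=> n; exact: measurable_funM.
  + exact: measurable_funM.
  + by move=> x _; apply: cvgM; [exact: cvg_cst|exact: phicvg].
  + by move=> n x _; apply: bnd; exact: normc_Re.
- under eq_fun do under eq_Rintegral do rewrite Im_mul /= mulr0 add0r.
  under eq_Rintegral do rewrite Im_mul /= mulr0 add0r.
  apply: (@dominated_Rintegral _ _ _ _ _ _ _ _ (fun x => M * Normc.normc (k x))) => //.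
  + by move=> n; exact: measurable_funM.
  + exact: measurable_funM.
  + by move=> x _; apply: cvgM; [exact: cvg_cst|exact: phicvg].
  + by move=> n x _; apply: bnd; exact: normc_Im.
Qed.

End KernelFunctional.

(** * Half lines as limits of exponentials *)

Section Lerch.
Context {R : realType}.
Local Notation C := (R[i]).
Local Notation mu := (@lebesgue_measure R).

(** Boundedness on continuous functions says nothing about the discontinuous [halfline]; stability
    under bounded pointwise limits, as for a complex measure on [[-b, b]], supplies the missing
    link. *)
Record continuous_functional (b : R) (L : (R -> C) -> C) : Prop := {
  cf_bounded : bounded_functional b L;
  cf_cvg : forall (phi_ : nat -> R -> R) (phi : R -> R) (M : R),
    (forall n, measurable_fun setT (phi_ n)) -> measurable_fun setT phi ->
    (forall n x, `|x| <= b -> `|phi_ n x| <= M) ->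
    (forall x, phi_ n x @[n --> \oo] --> phi x) ->
    complex.Re (L (fun x => (phi_ n x)%:C)) @[n --> \oo] -->
      complex.Re (L (fun x => (phi x)%:C)) /\
    complex.Im (L (fun x => (phi_ n x)%:C)) @[n --> \oo] -->
      complex.Im (L (fun x => (phi x)%:C)) }.

Lemma bounded_functionalD b L1 L2 :
  bounded_functional b L1 -> bounded_functional b L2 ->
  bounded_functional b (fun f : R -> C => L1 f + L2 f).
Proof.
move=> [l1 [K1 K10 H1]] [l2 [K2 K20 H2]]; split.
  by move=> c f g cf cg; rewrite l1 // l2 //; ring.
exists (K1 + K2); first exact: addr_ge0.
move=> f M cf fM; apply: le_trans (normcD _ _) _.
by rewrite mulrDl lerD ?H1 ?H2.
Qed.

Lemma bounded_functionalZ b (a : C) L : bounded_functional b L ->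
  bounded_functional b (fun f : R -> C => a * L f).
Proof.
move=> [l [K K0 H]]; split; first by move=> c f g cf cg; rewrite l //; ring.
exists (Normc.normc a * K); first by rewrite mulr_ge0 ?normc_ge0.
move=> f M cf fM; rewrite Normc.normcM -mulrA ler_wpM2l ?normc_ge0 //; exact: H.
Qed.

Lemma continuous_functionalD b L1 L2 :
  continuous_functional b L1 -> continuous_functional b L2 ->
  continuous_functional b (fun f : R -> C => L1 f + L2 f).
Proof.
move=> [b1 c1] [b2 c2]; split; first exact: bounded_functionalD.
move=> phi_ phi M m1 m2 H cv.
have [h1 h2] := c1 _ _ _ m1 m2 H cv; have [h3 h4] := c2 _ _ _ m1 m2 H cv.
split.
  rewrite Re_add; under eq_fun do rewrite Re_add.
  by apply: cvgD.
rewrite Im_add; under eq_fun do rewrite Im_add.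
by apply: cvgD.
Qed.

Lemma continuous_functional_eq0 b L (phi_ : nat -> R -> R) (phi : R -> R) (M : R) :
  continuous_functional b L ->
  (forall n, measurable_fun setT (phi_ n)) -> measurable_fun setT phi ->
  (forall n x, `|x| <= b -> `|phi_ n x| <= M) ->
  (forall x, phi_ n x @[n --> \oo] --> phi x) ->
  (forall n, L (fun x => (phi_ n x)%:C) = 0) -> L (fun x => (phi x)%:C) = 0.
Proof.
move=> HL m1 m2 H cv L0; have [h1 h2] := cf_cvg HL m1 m2 H cv.
apply: complex_eq.
  rewrite -(cvg_lim _ h1) //; under eq_fun do rewrite L0.
  exact: lim_cst.
rewrite -(cvg_lim _ h2) //; under eq_fun do rewrite L0.
exact: lim_cst.
Qed.

(* The limit of [exp (- exp (N (x - c)))] as [N] tends to infinity. *)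
Definition halfline (c x : R) : R :=
  if x < c then 1 else if x == c then expR (-1) else 0.

Lemma series_exp_coeff_le (y : R) n : 0 <= y -> series (exp_coeff y) n <= expR y.
Proof.
move=> y0; apply: nondecreasing_cvgn_le; last exact: is_cvg_series_exp_coeff.
apply/nondecreasing_seqP => m; rewrite seriesSr.
by rewrite lerDl exp_coeff_ge0.
Qed.

Lemma series_exp_coeffN_le (y : R) n : 0 <= y ->
  `|series (exp_coeff (- y)) n| <= expR y.
Proof.
move=> y0; apply: le_trans (series_exp_coeff_le n y0).
rewrite /series /=; apply: le_trans (ler_norm_sum _ _ _) _.
apply: ler_sum => i _.
by rewrite /exp_coeff /= normrM normrX normrN (ger0_norm y0) ger0_norm // invr_ge0.
Qed.

(** The Taylor partial sums of [exp (- y)] at [y = e^(N (x - c))] are finite combinations of real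
    exponentials, which [L] kills. On [[-b, b]] they are dominated by [exp y], hence by
    [exp (exp (N (b + |c|)))], so [cf_cvg] passes to the limit. *)
Lemma functional_double_exp b L (N c : R) : continuous_functional b L -> 0 <= N ->
  (forall w, L (expf w) = 0) ->
  L (fun x => (expR (- expR (N * (x - c))))%:C) = 0.
Proof.
move=> HL N0 L0.
pose phi_ n x := series (exp_coeff (- expR (N * (x - c)))) n.
have mexp : measurable_fun setT (fun x : R => expR (N * (x - c))).
  apply: (measurableT_comp (f := @expR R)) => //.
  by apply: measurable_funM => //; exact: measurable_funB.
apply: (@continuous_functional_eq0 b L phi_ _ (expR (expR (N * (b + `|c|))))) => //.
- move=> n; rewrite /phi_ /series /=; apply: measurable_sum => i.
  rewrite /exp_coeff /=; apply: measurable_funM => //.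
  exact/measurable_funX/measurableT_comp.
- by apply: (measurableT_comp (f := @expR R)) => //; exact: measurableT_comp.
- move=> n x xb; apply: le_trans (series_exp_coeffN_le n (expR_ge0 _)) _.
  rewrite !ler_expR ler_wpM2l //.
  by apply: lerD; [exact: le_trans (ler_norm _) xb|rewrite -normrN ler_norm].
- by move=> x; exact: is_cvg_series_exp_coeff.
have E i : (fun x : R => (exp_coeff (- expR (N * (x - c))) i)%:C) =
    (fun x => (((-1) ^+ i * expR (- (i%:R * N * c)) / i`!%:R)%:C) *
        expf ((i%:R * N)%:C) x).
  apply/funext => x; rewrite /expf -rmorphM cexp_real -rmorphM; congr (_%:C).
  rewrite /exp_coeff /= (exprNn (expR (N * (x - c))) i).
  rewrite (_ : expR (N * (x - c)) ^+ i = expR (- (i%:R * N * c)) * expR (i%:R * N * x)).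
    ring.
  by rewrite -expRD -expRM_natl; congr expR; ring.
have cE i : ccont (fun x : R => (exp_coeff (- expR (N * (x - c))) i)%:C).
  by rewrite E; apply: ccontZ; exact: ccont_expf.
have cphi n : ccont (fun x => (phi_ n x)%:C).
  elim: n => [|m IHm].
    rewrite (_ : (fun x => _) = fun=> 0); first exact: ccont_cst.
    by apply/funext => x; rewrite /phi_ /series /= big_nil.
  rewrite (_ : (fun x => _) = (fun x => (phi_ m x)%:C +
     (exp_coeff (- expR (N * (x - c))) m)%:C)); first exact: ccontD.
  by apply/funext => x; rewrite -rmorphD /phi_ seriesSr.
have HL' := cf_bounded HL.
elim=> [|n IH].
  rewrite (_ : (fun x => _) = fun=> 0) ?(bounded_functional0 HL') //.
  by apply/funext => x; rewrite /phi_ /series /= big_nil.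
rewrite (_ : (fun x => _) = (fun x => (phi_ n x)%:C +
     ((-1) ^+ n * expR (- (n%:R * N * c)) / n`!%:R)%:C * expf ((n%:R * N)%:C) x)).
  by rewrite (bf_linear HL') //; [rewrite IH L0 mulr0 addr0|exact: ccont_expf].
apply/funext => x; have := congr1 (fun f => f x) (E n) => /= <-.
by rewrite -rmorphD /phi_ seriesSr.
Qed.

Lemma measurable_halfline c : measurable_fun setT (halfline c).
Proof.
rewrite /halfline; apply: measurable_fun_ifT => //.
  exact: measurable_fun_ltr.
apply: measurable_fun_ifT => //.
exact: measurable_fun_eqr.
Qed.

Lemma cvg_expRN_natl (d : R) : 0 < d -> expR (- (n%:R * d)) @[n --> \oo] --> (0 : R).
Proof.
move=> d0; have : geometric 1 (expR (- d)) n @[n --> \oo] --> (0 : R).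
  apply: cvg_geometric; rewrite ger0_norm ?expR_ge0 //.
  by rewrite -expR0 ltr_expR oppr_lt0.
suff -> : geometric 1 (expR (- d)) = (fun n => expR (- (n%:R * d))) by [].
by apply/funext => n; rewrite /geometric /= mul1r -expRM_natl mulrN.
Qed.

Theorem functional_halfline b L : continuous_functional b L ->
  (forall w, L (expf w) = 0) -> forall c, L (fun x => (halfline c x)%:C) = 0.
Proof.
move=> HL L0 c.
apply: (@continuous_functional_eq0 b L
  (fun N x => expR (- expR (N%:R * (x - c)))) _ 1) => //.
- move=> n; apply: (measurableT_comp (f := @expR R)) => //.
  apply: measurableT_comp => //.
  apply: (measurableT_comp (f := @expR R)) => //.
  by apply: measurable_funM => //; exact: measurable_funB.
- exact: measurable_halfline.
- by move=> n x _; rewrite ger0_norm ?expR_ge0 // -expR0 ler_expR oppr_le0 expR_ge0.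
- move=> x; rewrite /halfline; have [xc|xc|->] := ltgtP x c; last first.
  + under eq_fun do rewrite subrr mulr0 expR0.
    exact: cvg_cst.
  + have x0 : 0 < x - c by rewrite subr_gt0.
    (* By [e^t >= 1 + t >= t], the double exponential is at most [e^(- n (x - c))]. *)
    apply: (@squeeze_cvgr _ _ _ _ (fun=> 0) (fun n => expR (- (n%:R * (x - c))))).
    * apply: nearW => n; rewrite expR_ge0 ler_expR lerN2 /=.
      by apply: le_trans (expR_ge1Dx _); rewrite lerDr.
    * exact: cvg_cst.
    * exact: cvg_expRN_natl.
  + have x0 : 0 < c - x by rewrite subr_gt0.
    have h := cvg_expRN_natl x0.
    under eq_fun do rewrite -(opprB c x) mulrN.
    have {}h : - expR (- (n%:R * (c - x))) @[n --> \oo] --> (- 0 : R) by exact: cvgN.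
    have := cvg_comp _ _ h (@continuous_expR R (- 0)).
    by rewrite oppr0 expR0.
by move=> n; exact: functional_double_exp HL _ L0.
Qed.

End Lerch.

(** * Absolutely continuous functions *)

Section AbsoluteContinuity.
Context {R : realType}.
Local Notation C := (R[i]).
Local Notation mu := (@lebesgue_measure R).

Lemma sum_lengths_measure (n : nat) (u v : 'I_n -> R) :
  (forall k, u k <= v k) -> trivIset setT (fun k => `]u k, v k[%classic) ->
  mu (\big[setU/set0]_(k < n) `]u k, v k[%classic) =
  (\sum_(k < n) (v k - u k))%:E.
Proof.
move=> uv tr; rewrite measure_semi_additive_ord //; last exact: bigsetU_measurable.
rewrite -sumEFin; apply: eq_bigr => k _.
rewrite [LHS](lebesgue_measure_itv `]u k, v k[) /= lte_fin; have [//|vu] := ltP (u k) (v k).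
by rewrite (_ : v k = u k) ?subrr //; apply/eqP; rewrite eq_le vu uv.
Qed.

Lemma derive0_small_increment (G : R -> R) (s e : R) : 0 < e ->
  is_derive s (1 : R) G 0 ->
  exists2 d, 0 < d & forall y, `|y - s| < d -> `|G y - G s| <= e * `|y - s|.
Proof.
move=> e0 /is_derive1_caratheodory[g [gE cg g0]].
have /cvgr0Pnorm_lt : g y @[y --> s] --> (0 : R) by rewrite -g0.
move=> /(_ e e0) [d /= d0 H]; exists d => // y ys.
rewrite gE normrM ler_wpM2r // ltW //; apply: H.
by rewrite /ball /= distrC.
Qed.

(** The invariant of the supremum argument: up to [x] the increment of [G] costs [e] per unit
    length, apart from finitely many disjoint intervals inside [O]. *)
Let step (A x e : R) (G : R -> R) (O : set R) : Prop :=
  exists n (u v : 'I_n -> R),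
  [/\ forall k, [/\ A <= u k, u k <= v k & v k <= x],
      trivIset setT (fun k => `]u k, v k[%classic),
      forall k, `]u k, v k[%classic `<=` O &
      `|G x - G A| <= e * (x - A) + \sum_(k < n) `|G (v k) - G (u k)|].

(** Across a point with zero derivative the family of intervals stays the same, and the new
    increment is charged to [e * (y - x)]. *)
Let step_derive (A s d x y e : R) (G : R -> R) (O : set R) :
  (forall y, `|y - s| < d -> `|G y - G s| <= e * `|y - s|) ->
  s - d < x -> x <= s -> s <= y -> y < s + d -> step A x e G O -> step A y e G O.
Proof.
move=> dG sx xs sy yd [n [u [v [uv tr uvO H]]]].
exists n, u, v; split => //.
  by move=> k; have [? ? vx] := uv k; split => //; lra.
have h1 := dG y; have h2 := dG x.
rewrite ger0_norm ?subr_ge0 // in h1; rewrite ler0_norm ?subr_le0 // opprB in h2.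
have {}h1 : `|G y - G s| <= e * (y - s) by apply: h1; lra.
have {}h2 : `|G x - G s| <= e * (s - x) by apply: h2; lra.
have := ler_normD (G y - G s) (G s - G x).
have := ler_normD (G y - G x) (G x - G A).
rewrite !addrA !subrK (distrC (G s)); nra.
Qed.

(** Inside [O] the derivative gives no information, so []x, y[] joins the family as its last member;
    the others end by [x], which keeps them disjoint from it. *)
Let step_open (A s d x y e : R) (G : R -> R) (O : set R) : 0 <= e ->
  (forall y, `|y - s| < d -> O y) -> A <= x ->
  s - d < x -> x <= s -> s <= y -> y < s + d -> step A x e G O -> step A y e G O.
Proof.
move=> e0 dO Ax sx xs sy yd [n [u [v [uv tr uvO H]]]].
have xy : x <= y by exact: le_trans xs sy.
pose u' (k : 'I_n.+1) := if unlift ord_max k is Some j then u j else x.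
pose v' (k : 'I_n.+1) := if unlift ord_max k is Some j then v j else y.
exists n.+1, u', v'; split.
- move=> k; rewrite /u' /v'; case: unliftP => [j _|_]; last by split.
  by have [? ? vx] := uv j; split => //; exact: le_trans vx xy.
- apply/trivIsetP => i j _ _; rewrite /u' /v'.
  case: unliftP => [i' ->|->]; case: unliftP => [j' ->|->].
  + move=> ij; move/trivIsetP : tr => /(_ i' j' I I); apply.
    by apply: contraNneq ij => ->.
  + move=> _; apply/seteqP; split => // z /=; rewrite !in_itv /= => -[/andP[_ zv] /andP[xz _]].
    by have [_ _ vx] := uv i'; lra.
  + move=> _; apply/seteqP; split => // z /=; rewrite !in_itv /= => -[/andP[xz _] /andP[_ zv]].
    by have [_ _ vx] := uv j'; lra.
  + by rewrite eqxx.
- move=> k; rewrite /u' /v'; case: unliftP => [j _|_]; first exact: uvO.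
  move=> z /=; rewrite in_itv /= => /andP[xz zy]; apply: dO.
  by rewrite ltr_norml; apply/andP; split; lra.
- rewrite big_ord_recr /= /u' /v' unlift_none.
  rewrite (eq_bigr (fun k : 'I_n => `|G (v k) - G (u k)|)); last first.
    move=> k _; rewrite (_ : widen_ord _ k = lift ord_max k) ?liftK //.
    by apply: val_inj => /=; rewrite /bump leqNgt ltn_ord.
  have := ler_normD (G y - G x) (G x - G A); rewrite addrA subrK.
  have : e * (x - A) <= e * (y - A) by rewrite ler_wpM2l // lerB.
  lra.
Qed.

(* The exceptional null set is covered by an open set [O] of small measure; a
   supremum argument then bounds the increment of [G] by the increments over
   intervals of [O] plus a term coming from the vanishing derivative. *)
Theorem abs_continuous_derive0 (A B : R) (G : R -> R) : A <= B ->
  abs_continuous A B G ->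
  {ae mu, forall x, x \in `]A, B[ -> is_derive x (1 : R) G 0} -> G B = G A.
Proof.
move=> AB acG [N [mN N0 HN]].
suff H e : 0 < e -> `|G B - G A| <= e * (B - A) + e.
  apply/eqP; rewrite -subr_eq0 -normr_le0.
  apply/ler_addgt0Pl => e e0; rewrite addr0.
  have BA1 : 0 < B - A + 1 by lra.
  have := H (e / (B - A + 1)) (divr_gt0 e0 BA1).
  rewrite (_ : e / _ * _ + _ = e) //.
  by field; rewrite gt_eqF.
move=> e0.
have [d d0 acd] := acG e e0.
(* The derivative is known only inside []A, B[], so the end points join the exceptional set. *)
have N'0 : mu (N `|` [set A] `|` [set B]) = 0%E.
  apply/eqP; rewrite eq_le measure_ge0 andbT.
  apply: le_trans (measureU2 _ _ _) _ => //; first exact: measurableU.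
  rewrite [X in (_ + X)%E](lebesgue_measure_set1 B) adde0.
  apply: le_trans (measureU2 _ _ _) _ => //.
  by rewrite [X in (_ + X)%E](lebesgue_measure_set1 A) adde0 [leLHS]N0.
have mN' : measurable (N `|` [set A] `|` [set B]) by apply: measurableU => //; exact: measurableU.
have [W [oO NO Od]] := @lebesgue_regularity_outer R _ d mN'
  (eq_ind_r (fun t => (t < +oo)%E) (ltry 0) N'0) d0.
have mO : measurable W by exact: open_measurable.
have {}Od : (mu W < d%:E)%E.
  rewrite -(setDUK NO); apply: le_lt_trans (measureU2 _ _ _) _ => //.
    exact: measurableD.
  by rewrite [X in (X + _)%E]N'0 add0e.
have fam_small x : x <= B -> step A x e G W -> `|G x - G A| <= e * (x - A) + e.
  move=> xB [n [u [v [uv tr uvO H]]]]; apply: le_trans H _.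
  rewrite lerD2l ltW //; apply: acd => //.
    by move=> k; have [? ? ?] := uv k; split => //; lra.
  rewrite -lte_fin -sum_lengths_measure //; last by move=> k; case: (uv k).
  apply: le_lt_trans Od; apply: le_measure; rewrite ?inE //.
    exact: bigsetU_measurable.
  apply: (big_ind (fun X => X `<=` W)) => // X Y XW YW.
  by rewrite subUset.
apply: fam_small => //.
pose S := [set x | [/\ A <= x, x <= B & step A x e G W]].
have SA : S A.
  split => //; exists 0%N, (fun=> 0), (fun=> 0); split; try by case.
  by rewrite big_ord0 !subrr mulr0 addr0 normr0.
have hS : has_sup S by split; [exists A|exists B => x []].
pose s := sup S.
have As : A <= s by exact: ub_le_sup hS.2 _ SA.
have sB : s <= B by apply: ge_sup; [exists A|move=> x []].
(* Either [s] is exceptional and has a neighbourhood inside [W], or [G] has derivative 0 at [s]; in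
   both cases the invariant crosses [s]. *)
have [r r0 Hr] : exists2 r, 0 < r & forall x y, A <= x -> s - r < x -> x <= s ->
    s <= y -> y < s + r -> step A x e G W -> step A y e G W.
  have [sN|sN] := pselect ((N `|` [set A] `|` [set B]) s).
    have /nbhs_ballP[r /= r0 rO] : nbhs s W by apply: open_nbhs_nbhs; split => //; exact: NO.
    exists r => // x y Ax; apply: step_open => //; first exact: ltW.
    by move=> z zs; apply: rO; rewrite /ball /= distrC.
  have ds : is_derive s (1 : R) G 0.
    apply: contrapT => nd; apply: (sN); left; left; apply: HN => /= /(_ _) h.
    apply: nd; apply: h; rewrite in_itv /= !lt_neqAle As sB !andbT.
    by apply/andP; split; apply/eqP => h'; apply: sN; [left; right|right].
  have [r r0 Hr] := derive0_small_increment e0 ds.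
  by exists r => // x y Ax; exact: step_derive.
have [x [Ax xB Sx] sx] := sup_adherent r0 hS.
have xs : x <= s by apply: ub_le_sup hS.2 _ _; split.
have Ss : step A s e G W by apply: (Hr x s) => //; rewrite ltrDl.
have [sB'|Bs] := ltP s B; last by rewrite (_ : B = s) //; apply/eqP; rewrite eq_le sB Bs.
(* If [s < B], this point of [S] lies beyond the supremum. *)
pose y := Num.min (s + r / 2) B.
have sy : s < y by rewrite lt_min sB' andbT ltrDl divr_gt0.
suff : y <= s by rewrite leNgt sy.
apply: ub_le_sup hS.2 _ _; split.
- by apply: le_trans As _; exact: ltW.
- by rewrite ge_min lexx orbT.
- apply: (Hr x y) => //; first exact: ltW.
  by apply: (@le_lt_trans _ _ (s + r / 2)); rewrite ?ge_min ?lexx // ltrD2l; lra.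
Qed.

End AbsoluteContinuity.

(** * The fundamental theorem of calculus for absolutely continuous functions *)

Section FundamentalTheorem.
Context {R : realType}.
Local Notation C := (R[i]).
Local Notation mu := (@lebesgue_measure R).
Implicit Types (A B : R) (F G h : R -> R).

Lemma abs_continuous_subinterval A B A' B' F : A <= A' -> B' <= B ->
  abs_continuous A B F -> abs_continuous A' B' F.
Proof.
move=> AA' BB' acF e e0; have [d d0 H] := acF e e0; exists d => // n u v uv.
by apply: H => k; have [? ? ?] := uv k; split => //; lra.
Qed.

Lemma abs_continuousD A B F G : abs_continuous A B F -> abs_continuous A B G ->
  abs_continuous A B (fun x => F x + G x).
Proof.
move=> acF acG e e0; have e20 : 0 < e / 2 by rewrite divr_gt0.
have [d1 d10 H1] := acF _ e20; have [d2 d20 H2] := acG _ e20.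
exists (Num.min d1 d2); first by rewrite lt_min d10.
move=> n u v uv tr; rewrite lt_min => /andP[s1 s2].
have := ltrD (H1 _ _ _ uv tr s1) (H2 _ _ _ uv tr s2); rewrite -splitr.
apply: le_lt_trans; rewrite -big_split; apply: ler_sum => k _ /=.
by rewrite opprD addrACA ler_normD.
Qed.

Lemma abs_continuousZ A B (c : R) F : abs_continuous A B F ->
  abs_continuous A B (fun x => c * F x).
Proof.
move=> acF e e0; have c0 : 0 < `|c| + 1 by rewrite ltr_wpDl.
have [d d0 H] := acF _ (divr_gt0 e0 c0); exists d => // n u v uv tr s.
have := H _ _ _ uv tr s; rewrite ltr_pdivlMr //; apply: le_lt_trans.
rewrite mulr_suml; apply: ler_sum => k _.
by rewrite -mulrBr normrM mulrC ler_wpM2l // lerDl.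
Qed.

(** Steps shorter than [d] change [F] by less than 1, and finitely many steps of length [d / 2]
    cross [[A, B]]. *)
Lemma abs_continuous_bounded A B F : abs_continuous A B F ->
  exists2 K, 0 <= K & forall x, x \in `[A, B] -> `|F x| <= K.
Proof.
move=> /(_ 1 ltr01)[d d0 H].
have step x y : A <= x -> x <= y -> y <= B -> y - x < d -> `|F y - F x| < 1.
  move=> Ax xy yB yx.
  have := H 1%N (fun=> x) (fun=> y); rewrite !big_ord1; apply => //.
  by apply/trivIsetP => i j _ _; rewrite !ord1 eqxx.
have K k x : A <= x -> x <= B -> x <= A + k%:R * (d / 2) -> `|F x| <= `|F A| + k%:R.
  elim: k x => [|k IH] x Ax xB.
    by rewrite mul0r addr0 => xA; rewrite (_ : x = A) ?addr0 //; apply/eqP; rewrite eq_le xA.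
  move=> xk; rewrite -natr1.
  pose y := Num.max A (x - d / 2).
  have yx : y <= x by rewrite ge_max Ax /=; lra.
  have Ay : A <= y by rewrite le_max lexx.
  have xy : x - d / 2 <= y by rewrite le_max lexx orbT.
  have := IH y Ay (le_trans yx xB).
  have yk : y <= A + k%:R * (d / 2).
    rewrite ge_max lerDl mulr_ge0 ?divr_ge0 ?(ltW d0) //=.
    by rewrite lerBlDr -addrA -[X in _ + (_ + X)]mul1r -mulrDl natr1.
  move=> /(_ yk) hy; have := step y x Ay yx xB; rewrite ltrBlDr => hs.
  have {}hs : `|F x - F y| < 1 by apply: hs; lra.
  have := ler_normD (F x - F y) (F y); rewrite subrK; lra.
pose k := Num.truncn ((B - A) / (d / 2)).
exists (`|F A| + k.+1%:R) => // x; rewrite in_itv /= => /andP[Ax xB].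
apply: K => //; have := truncnS_gt ((B - A) / (d / 2)).
rewrite ltr_pdivrMr ?divr_gt0 // -/k; lra.
Qed.

Lemma abs_continuousM A B F G : abs_continuous A B F -> abs_continuous A B G ->
  abs_continuous A B (fun x => F x * G x).
Proof.
move=> acF acG e e0.
have [K K0 HK] := abs_continuous_bounded acF.
have [M M0 HM] := abs_continuous_bounded acG.
have e20 : 0 < e / 2 by rewrite divr_gt0.
have [d1 d10 H1] := abs_continuousZ M acF e20.
have [d2 d20 H2] := abs_continuousZ K acG e20.
exists (Num.min d1 d2); first by rewrite lt_min d10.
move=> n u v uv tr; rewrite lt_min => /andP[s1 s2].
have := ltrD (H1 _ _ _ uv tr s1) (H2 _ _ _ uv tr s2); rewrite -splitr.
apply: le_lt_trans; rewrite -big_split; apply: ler_sum => k _ /=.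
rewrite -!mulrBr !normrM (ger0_norm M0) (ger0_norm K0).
have [Au uv' vB] := uv k.
have hu : `|G (u k)| <= M by apply: HM; rewrite in_itv /=; apply/andP; split; lra.
have hv : `|F (v k)| <= K by apply: HK; rewrite in_itv /=; apply/andP; split; lra.
rewrite (_ : F (v k) * G (v k) - F (u k) * G (u k) =
  (F (v k) - F (u k)) * G (u k) + F (v k) * (G (v k) - G (u k))); last by ring.
apply: le_trans (ler_normD _ _) _; rewrite !normrM lerD //.
  by rewrite mulrC ler_wpM2r.
by rewrite ler_wpM2r.
Qed.

Lemma abs_continuous_is_derive A B F h K :
  (forall x, x \in `[A, B] -> is_derive x (1 : R) F (h x)) ->
  (forall x, x \in `[A, B] -> `|h x| <= K) -> abs_continuous A B F.
Proof.
move=> dF hK e e0.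
have K0 : 0 < `|K| + 1 by rewrite ltr_wpDl.
exists (e / (`|K| + 1)); first by rewrite divr_gt0.
move=> n u v uv tr; rewrite ltr_pdivlMr //; apply: le_lt_trans.
rewrite mulr_suml; apply: ler_sum => k _; have [Au uv' vB] := uv k.
have sub x : x \in `[u k, v k] -> x \in `[A, B].
  by rewrite !in_itv /= => /andP[? ?]; apply/andP; split; lra.
have dF' x : x \in `]u k, v k[ -> is_derive x (1 : R) F (h x).
  by move=> xuv; apply/dF/sub; exact: subset_itv_oo_cc xuv.
have cF : {within `[u k, v k], continuous F}.
  by apply: derivable_within_continuous => x /sub xAB; case: (dF x xAB).
have [c cuv E] := MVT_segment uv' dF' cF.
rewrite E normrM mulrC ger0_norm ?subr_ge0 // ler_wpM2l ?subr_ge0 //.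
apply: le_trans (hK _ (sub _ cuv)) _; apply: le_trans (ler_norm _) _.
by rewrite lerDl.
Qed.

Lemma integrable_itv (a b : itv_bound R) h : mu.-integrable setT (EFin \o h) ->
  mu.-integrable [set` Interval a b] (EFin \o h).
Proof. by move=> hi; exact: integrableS hi. Qed.

Lemma abs_continuous_primitive A B h : mu.-integrable setT (EFin \o h) ->
  abs_continuous A B (fun x => \int[mu]_(t in `]-oo, x]) h t).
Proof.
move=> hi e e0; have [d [d0 H]] := integral_normr_continuous hi e0.
exists d => // n u v uv tr s.
pose F k := `]u k, v k[%classic.
have uv' k : u k <= v k by case: (uv k).
have mF : measurable (\big[setU/set0]_(k < n) F k).
  by apply: bigsetU_measurable => k _; exact: measurable_itv.
have muF : (mu (\big[setU/set0]_(k < n) F k) < d%:E)%E.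
  by rewrite sum_lengths_measure // lte_fin.
rewrite -lte_fin.
have hn := integrable_norm hi.
have := H _ mF muF; rewrite -lte_fin; apply: le_lt_trans.
rewrite /Rintegral fineK; last first.
  by apply: integrable_fin_num => //; exact: integrableS hn.
rewrite ge0_integral_bigsetU //=; last 4 first.
- by move=> k; exact: measurable_itv.
- exact: index_enum_uniq.
- by apply: sub_trivIset tr.
- by apply: measurable_funTS; exact: measurable_int hn.
rewrite -sumEFin; apply: lee_sum => k _.
rewrite (_ : fine _ - fine _ = \int[mu]_(t in F k) h t); last first.
  rewrite /F Rintegral_itv_bndo_bndc; last exact: integrable_itv hi.
  by rewrite -(@Rintegral_itvB R h -oo%O (BRight (v k)) (u k)) ?bnd_simp //; exact: integrable_itv hi.
have mFk : measurable (F k) by exact: measurable_itv.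
rewrite EFin_normr_Rintegral //; last exact: integrable_itv hi.
apply: le_abse_integral => //.
by apply: measurable_funTS; exact: measurable_int hi.
Qed.

(** [F] minus the primitive of [h] is absolutely continuous with derivative zero almost everywhere,
    hence takes equal values at both ends. *)
Theorem abs_continuous_FTC A B F h : A <= B -> abs_continuous A B F ->
  mu.-integrable setT (EFin \o h) ->
  {ae mu, forall x, x \in `]A, B[ -> is_derive x (1 : R) F (h x)} ->
  F B - F A = \int[mu]_(x in `]A, B]) h x.
Proof.
move=> AB acF hi dF.
pose H x := \int[mu]_(t in `]-oo, x]) h t.
have dH : {ae mu, forall x, is_derive x (1 : R) H (h x)}.
  have hl : locally_integrable setT h by apply: open_integrable_locally => //; exact: openT.
  have := FTC1Ny (fun y => integrable_itv -oo%O (BRight y) hi) hl.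
  apply: filterS; first exact: (ae_filter_ringOfSetsType mu).
  move=> x [d E]; apply: DeriveDef; first exact: d.
  by rewrite -E derive1E.
have := @abs_continuous_derive0 R A B (fun x => F x + -1 * H x) AB
  (abs_continuousD acF (abs_continuousZ (-1) (abs_continuous_primitive A B hi))).
have aeD : {ae mu, forall x, x \in `]A, B[ ->
    is_derive x (1 : R) (fun x => F x + -1 * H x) 0}.
  apply: filterS2 dF dH; first exact: (ae_filter_ringOfSetsType mu).
  move=> x dFx dHx xAB.
  have := dFx xAB => {}dFx.
  rewrite (_ : (fun x => _) = F + (-1) *: H); last by apply/funext.
  apply: is_derive_eq (is_deriveD dFx (is_deriveZ (-1) dHx)) _.
  by rewrite /GRing.scale /= mulN1r subrr.
move=> /(_ aeD) E.
rewrite -(@Rintegral_itvB R h -oo%O (BRight B) A) ?bnd_simp //; last first.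
  exact: integrable_itv hi.
by rewrite -/(H B) -/(H A); lra.
Qed.

End FundamentalTheorem.

(** * Integrals on the line: vanishing densities, variation of constants, Fubini *)

Section ComplexLine.
Context {R : realType}.
Local Notation C := (R[i]).
Local Notation mu := (@lebesgue_measure R).

Lemma ae_eq0_of_constant_primitive (f : R -> R) (al be c : R) :
  mu.-integrable setT (EFin \o f) ->
  (forall x, x \in `]al, be[ -> \int[mu]_(t in `]-oo, x]) f t = c) ->
  {ae mu, forall x, x \in `]al, be[ -> f x = 0}.
Proof.
move=> fi fc.
have hl : locally_integrable setT f by apply: open_integrable_locally => //; exact: openT.
have := FTC1Ny (fun y => integrable_itv -oo%O (BRight y) fi) hl.
apply: filterS; first exact: (ae_filter_ringOfSetsType mu).
move=> x [d E] xab; rewrite -E derive1E.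
rewrite (@near_eq_derive _ _ _ _ (cst c)) ?derive_cst //.
have := near_in_itvoo xab; apply: filterS => y yab /=.
exact: fc.
Qed.

Lemma integrable_measurable (f : R -> R) :
  mu.-integrable setT (EFin \o f) -> measurable_fun setT f.
Proof. by move=> /measurable_int/measurable_EFinP. Qed.

Lemma ae_neq (x : R) : {ae mu, forall t, t <> x}.
Proof.
exists [set x]; split => //; first exact: lebesgue_measure_set1.
by move=> t /= /contrapT.
Qed.

(** The test function is 1 for [t > x] and 0 for [t < x], so the hypothesis makes the tail integral
    of [f] constant in [x], and with it the primitive. The value at [t = x] is lost in a null
    set. *)
Lemma ae_eq0_of_halfline_real (f : R -> R) (s al be c : R) :
  mu.-integrable setT (EFin \o f) ->
  (forall x, x \in `]al, be[ ->
    \int[mu]_t (f t * halfline (s - 2 * x) (s - 2 * t)) = c) ->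
  {ae mu, forall x, x \in `]al, be[ -> f x = 0}.
Proof.
move=> fi fc.
apply: (@ae_eq0_of_constant_primitive _ _ _ (\int[mu]_t f t - c)) => // x xab.
have mh : measurable_fun setT (fun t : R => halfline (s - 2 * x) (s - 2 * t)).
  apply: measurableT_comp; first exact: measurable_halfline.
  by apply: measurable_funB => //; exact: measurable_funM.
have fm : measurable_fun setT f by exact: integrable_measurable.
have fhi : mu.-integrable setT (EFin \o (fun t => f t * halfline (s - 2 * x) (s - 2 * t))).
  apply: (le_integrable measurableT _ _ fi).
    by apply/measurable_EFinP; exact: measurable_funM.
  move=> t _ /=; rewrite lee_fin normrM ler_piMr // /halfline.
  case: ifP => _; first by rewrite normr1.
  case: ifP => _; last by rewrite normr0.
  by rewrite ger0_norm ?expR_ge0 // -[leRHS]expR0 ler_expR; lra.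
rewrite -(fc x xab) -RintegralB //.
rewrite Rintegral_mkcond /Rintegral; congr fine.
apply: ae_eq_integral => //.
- apply/measurable_EFinP; apply/(measurable_restrictT _ _).1 => //.
  exact: measurable_funTS.
- by apply/measurable_EFinP; apply: measurable_funB => //; exact: measurable_funM.
apply: filterS (ae_neq x); first exact: (ae_filter_ringOfSetsType mu).
move=> t tx _ /=; congr (_%:E); rewrite patchE /halfline.
have [xt|xt|xt] := ltgtP x t; last by case: tx.
  have -> : s - 2 * t < s - 2 * x by lra.
  by rewrite memNset ?mulr1 ?subrr //= in_itv /= leNgt xt.
have -> : (s - 2 * t < s - 2 * x) = false by apply/negbTE; rewrite -leNgt; lra.
have -> : (s - 2 * t == s - 2 * x) = false by apply/negbTE/eqP => h; apply: tx; lra.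
by rewrite mem_set ?mulr0 ?subr0 //= in_itv /= ltW.
Qed.

Lemma ae_eq0_of_halfline (k : R -> C) (s al be : R) (c : C) :
  cintegrable mu setT k ->
  (forall x, x \in `]al, be[ ->
    kernel_functional mu k (fun t => s - 2 * t)
      (fun y => (halfline (s - 2 * x) y)%:C) = c) ->
  {ae mu, forall x, x \in `]al, be[ -> k x = 0}.
Proof.
move=> [k1 k2] kc.
have h1 := @ae_eq0_of_halfline_real _ s al be (complex.Re c) k1.
have h2 := @ae_eq0_of_halfline_real _ s al be (complex.Im c) k2.
apply: filterS2 (h1 _) (h2 _); first exact: (ae_filter_ringOfSetsType mu).
- by move=> x e1 e2 xab; apply: complex_eq; rewrite ?e1 ?e2.
- move=> x xab; rewrite -(kc x xab) /kernel_functional /cint /=.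
  by apply: eq_Rintegral => t _; rewrite Re_mul /= mulr0 subr0.
- move=> x xab; rewrite -(kc x xab) /kernel_functional /cint /=.
  by apply: eq_Rintegral => t _; rewrite Im_mul /= mulr0 add0r.
Qed.

Lemma abs_continuousCM A B (f g : R -> C) :
  abs_continuousC A B f -> abs_continuousC A B g ->
  abs_continuousC A B (fun x => f x * g x).
Proof.
move=> [f1 f2] [g1 g2]; split.
  rewrite (_ : (fun x => _) = (fun x => complex.Re (f x) * complex.Re (g x) +
    -1 * (complex.Im (f x) * complex.Im (g x)))).
    by apply: abs_continuousD; [|apply: abs_continuousZ]; exact: abs_continuousM.
  by apply/funext => x; rewrite Re_mul mulN1r.
rewrite (_ : (fun x => _) = (fun x => complex.Re (f x) * complex.Im (g x) +
    complex.Im (f x) * complex.Re (g x))).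
  by apply: abs_continuousD; exact: abs_continuousM.
by apply/funext => x; rewrite Im_mul.
Qed.

Lemma abs_continuousC_is_derive A B (F f : R -> C) :
  (forall x, is_deriveC x F (f x)) -> ccont f -> abs_continuousC A B F.
Proof.
move=> dF cf.
have [M HM] := ccont_bounded (`|A| + `|B|) cf.
have AB x : x \in `[A, B] -> `|x| <= `|A| + `|B|.
  rewrite in_itv /= => /andP[Ax xB]; rewrite ler_norml.
  have := ler_norm B; have := lerNnormlW (lexx `|A|).
  by have := normr_ge0 A; have := normr_ge0 B; lra.
split.
  apply: (@abs_continuous_is_derive _ _ _ _ (fun x => complex.Re (f x)) M) => x.
    by move=> _; case: (dF x).
  by move=> /AB /HM; apply: le_trans; exact: normc_Re.
apply: (@abs_continuous_is_derive _ _ _ _ (fun x => complex.Im (f x)) M) => x.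
  by move=> _; case: (dF x).
by move=> /AB /HM; apply: le_trans; exact: normc_Im.
Qed.

Theorem abs_continuousC_FTC A B (F h : R -> C) : A <= B ->
  abs_continuousC A B F -> cintegrable mu setT h ->
  {ae mu, forall x, x \in `]A, B[ -> is_deriveC x F (h x)} ->
  F B - F A = cint mu `]A, B] h.
Proof.
move=> AB [ac1 ac2] [h1 h2] dF; apply: complex_eq; rewrite ?Re_add ?Im_add ?Re_opp ?Im_opp /=.
  apply: (abs_continuous_FTC AB ac1 h1); apply: filterS dF.
    exact: (ae_filter_ringOfSetsType mu).
  by move=> x H xAB; case: (H xAB).
apply: (abs_continuous_FTC AB ac2 h2); apply: filterS dF.
  exact: (ae_filter_ringOfSetsType mu).
by move=> x H xAB; case: (H xAB).
Qed.

(** The derivative of [e^(- z t) F(t)] is [e^(- z t) h(t)]. The bounded support of [h] keeps the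
    latter integrable over the whole line. *)
Theorem variation_of_constants A B b (z : C) (F h : R -> C) : A <= B ->
  abs_continuousC A B F -> cintegrable mu setT h ->
  (forall x, h x != 0 -> `|x| <= b) ->
  {ae mu, forall x, x \in `]A, B[ -> is_deriveC x F (z * F x + h x)} ->
  expf (- z) B * F B - expf (- z) A * F A =
    cint mu `]A, B] (fun t => h t * expf (- z) t).
Proof.
move=> AB acF hi hb dF.
have ce := ccont_expf (- z).
have [M HM] := ccont_bounded b ce.
apply: (@abs_continuousC_FTC _ _ (fun t => expf (- z) t * F t)) => //.
- apply: abs_continuousCM => //.
  apply: (@abs_continuousC_is_derive _ _ _ (fun x => - z * expf (- z) x)).
    by move=> x; exact: is_deriveC_cexp.
  exact: ccontZ.
- apply: (cintegrableM_bounded measurableT hi (M := M)).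
    exact: (@ccont_cmeasurable _ _ _ id _ _ ce).
  by move=> x _ /hb; exact: HM.
apply: filterS dF; first exact: (ae_filter_ringOfSetsType mu).
move=> x H xAB; apply: is_deriveC_eq (is_deriveCM (is_deriveC_cexp x (- z)) (H xAB)) _.
rewrite /expf; ring.
Qed.

Lemma integrable_tensor (f g : R -> R) :
  mu.-integrable setT (EFin \o f) -> mu.-integrable setT (EFin \o g) ->
  (mu \x mu)%E.-integrable setT (fun p : R * R => (f p.1 * g p.2)%:E).
Proof.
move=> fi gi.
have fm := integrable_measurable fi; have gm := integrable_measurable gi.
apply/integrable12ltyP.
  apply/measurable_EFinP; apply: measurable_funM.
    by apply: measurableT_comp => //; exact: measurable_fst.
  by apply: measurableT_comp => //; exact: measurable_snd.
have fn := integrable_norm fi; have gn := integrable_norm gi.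
pose G := \int[mu]_y `|g y|.
have E x : (\int[mu]_y `|(f x * g y)%:E|)%E = (G * `|f x|)%:E.
  have gfi := integrableZl measurableT `|f x| gn.
  under eq_integral do rewrite /= normrM.
  rewrite mulrC -RintegralZl // /Rintegral fineK //.
  exact: integrable_fin_num gfi.
under eq_integral do rewrite E.
have fgi := integrableZl measurableT G fn.
have H : (\int[mu]_x (G * `|f x|)%:E)%E \is a fin_num by exact: integrable_fin_num fgi.
by rewrite -(fineK H) ltry.
Qed.

Lemma cintegrable_tensor (f g : R -> C) :
  cintegrable mu setT f -> cintegrable mu setT g ->
  cintegrable (mu \x mu)%E setT (fun p : R * R => f p.1 * g p.2).
Proof.
move=> [f1 f2] [g1 g2]; split.
  under eq_fun do rewrite Re_mul EFinB.
  exact: (integrableB measurableT (integrable_tensor f1 g1) (integrable_tensor f2 g2)).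
under eq_fun do rewrite Im_mul EFinD.
exact: (integrableD measurableT (integrable_tensor f1 g2) (integrable_tensor f2 g1)).
Qed.

(** Integrability of every section, rather than of almost every one, identifies the inner real
    integral with [fubini_F] at each point. *)
Lemma Rintegral_fubini (k : R * R -> R) :
  (mu \x mu)%E.-integrable setT (EFin \o k) ->
  (forall x, mu.-integrable setT (fun y => (k (x, y))%:E)) ->
  mu.-integrable setT (fun x => (\int[mu]_y k (x, y))%:E) /\
  \int[(mu \x mu)%E]_p k p = \int[mu]_x \int[mu]_y k (x, y).
Proof.
move=> ki kxi.
have E : fubini_F mu (EFin \o k) = fun x => (\int[mu]_y k (x, y))%:E.
  apply/funext => x; rewrite /fubini_F /Rintegral fineK //.
  exact: integrable_fin_num (kxi x).
split; first by rewrite -E; exact: integrable_fubini_F.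
suff h : (\int[mu]_x (fun x => (\int[mu]_y k (x, y))%:E) x =
    \int[mu \x mu]_p (EFin \o k) p)%E by exact: (congr1 fine (esym h)).
by rewrite -E; exact: integral12_prod_meas1.
Qed.

Lemma cint_fubini (k : R * R -> C) :
  cintegrable (mu \x mu)%E setT k ->
  (forall x, cintegrable mu setT (fun y => k (x, y))) ->
  cintegrable mu setT (fun x => cint mu setT (fun y => k (x, y))) /\
  cint (mu \x mu)%E setT k = cint mu setT (fun x => cint mu setT (fun y => k (x, y))).
Proof.
move=> [k1 k2] kx.
have [i1 e1] := Rintegral_fubini k1 (fun x => (kx x).1).
have [i2 e2] := Rintegral_fubini k2 (fun x => (kx x).2).
by split; [split|apply: complex_eq].
Qed.

End ComplexLine.

(** * The scalar delay system *)

Section DelaySystem.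
Context {R : realType}.
Local Notation C := (R[i]).
Local Notation mu := (@lebesgue_measure R).

Lemma expfD (z : C) x y : expf z (x + y) = expf z x * expf z y.
Proof. by rewrite /expf rmorphD mulrDr cexpD. Qed.

Lemma expfN (z : C) x : expf (- z) x = expf z (- x).
Proof. by rewrite /expf rmorphN mulrN mulNr. Qed.

Lemma expf0 (z : C) : expf z 0 = 1.
Proof. by rewrite /expf mulr0 cexp0. Qed.

Lemma expfK (z : C) x (y : C) : expf z x * (expf z (- x) * y) = y.
Proof. by rewrite mulrA -expfD subrr expf0 mul1r. Qed.

Lemma cint_mkcond (D : set R) (f : R -> C) :
  cint mu D f = cint mu setT (fun x => if x \in D then f x else 0).
Proof.
have E (h : R -> R) (k : R -> R) : (forall x, k x = if x \in D then h x else 0) ->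
    \int[mu]_(x in D) h x = \int[mu]_x k x.
  move=> hk; rewrite [LHS]Rintegral_mkcond.
  by apply: eq_Rintegral => x _; rewrite hk patchE; case: ifP.
by congr (_ +i* _); apply: E => x; case: ifP.
Qed.

Lemma ae_itv_sub (P : R -> Prop) (A B A' B' : R) : A <= A' -> B' <= B ->
  {ae mu, forall x, x \in `]A, B[ -> P x} ->
  {ae mu, forall x, x \in `]A', B'[ -> P x}.
Proof.
move=> AA BB; apply: filterS; first exact: (ae_filter_ringOfSetsType mu).
move=> x + xAB; apply; move: xAB; rewrite !in_itv /= => /andP[h1 h2].
by apply/andP; split; lra.
Qed.

Lemma abs_continuousC_sub A B A' B' (F : R -> C) : A <= A' -> B' <= B ->
  abs_continuousC A B F -> abs_continuousC A' B' F.
Proof. by move=> h1 h2 [? ?]; split; exact: abs_continuous_subinterval h1 h2 _. Qed.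

Variable a : R.
Hypotheses (a_gt0 : 0 < a) (a_lt_pi : a < pi) (pi_le_3a : pi <= 3 * a).

(** The support condition holds at every point, not only almost everywhere, so integrals over
    subintervals extend to the whole line without change. *)
Definition delay_supported (f : R -> C) : Prop :=
  cintegrable mu setT f /\ forall x, f x != 0 -> a < x < pi.

Definition delay_solution (z : C) (f y y2 : R -> C) : Prop :=
  [/\ abs_continuousC 0 pi y, y 0 = 1 &
     {ae mu, forall x, x \in `]0, pi[ -> is_deriveC x y (z * y x + f x * y2 (x - a))}].

(** Up to [a] the source term vanishes, so the form of [y2] does not matter here. *)
Lemma delay_solution_initial z f y y2 : delay_supported f ->
  delay_solution z f y y2 -> forall x, x \in `[0, a] -> y x = expf z x.
Proof.
move=> [fi fs] [acy y0 dy] x; rewrite in_itv /= => /andP[x0 xa].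
have xpi : x <= pi by exact: le_trans xa (ltW a_lt_pi).
have acx : abs_continuousC 0 x y by exact: abs_continuousC_sub acy.
have i0 : cintegrable mu setT (fun=> 0 : C) by split; exact: integrable0.
have dx : {ae mu, forall t, t \in `]0, x[ -> is_deriveC t y (z * y t + 0)}.
  apply: filterS (ae_itv_sub (lexx 0) xpi dy).
    exact: (ae_filter_ringOfSetsType mu).
  move=> t + tx => /(_ tx); have [->|/fs/andP[ta _]] := eqVneq (f t) 0.
    by rewrite mul0r.
  by move: tx; rewrite in_itv /= => /andP[_ tx]; have := lt_trans ta (lt_le_trans tx xa); rewrite ltxx.
have := @variation_of_constants R 0 x 0 z y (fun=> 0) x0 acx i0 _ dx.
rewrite y0 mulr1 !expfN oppr0 expf0 => E.
have {}E := E (fun t h => False_ind _ (elimN eqP h erefl)).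
have E0 : cint mu `]0, x] (fun t => 0 * expf (- z) t) = 0.
  rewrite (_ : (fun t => _) = fun=> 0); last by apply/funext => t; rewrite mul0r.
  by apply: complex_eq; rewrite /cint /= /Rintegral integral0.
rewrite E0 in E; move/eqP: E; rewrite subr_eq0 => /eqP E.
by rewrite -[LHS](expfK z x) E mulr1.
Qed.

Lemma delay_supported_cintegrableM (f : R -> C) (phi : R -> C) (theta : R -> R) :
  delay_supported f -> ccont phi -> measurable_fun setT theta ->
  (forall x, a < x < pi -> `|theta x| <= 3 * pi) ->
  cintegrable mu setT (fun x => f x * phi (theta x)).
Proof.
move=> [fi fs] cphi mt tb; have [M HM] := ccont_bounded (3 * pi) cphi.
apply: (cintegrableM_bounded measurableT fi (ccont_cmeasurable mt cphi) (M := M)).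
by move=> x _ /fs /tb; exact: HM.
Qed.

Lemma cint_delay_supported (A B : R) (f : R -> C) :
  (forall x, f x != 0 -> A < x <= B) -> cint mu `]A, B] f = cint mu setT f.
Proof.
move=> fs; rewrite cint_mkcond; apply: eq_cint => x _.
case: ifP => // xn; apply/eqP; rewrite eq_sym; apply: contraFT xn => /fs.
by move=> h; apply: mem_set; rewrite /= in_itv.
Qed.

(** For [x <= 2 a] the delayed argument stays in [[0, a]], where [y2] is a pure exponential. The
    phase [a - 2 s] is [- (s - a)] from [y2] plus [- s] from the integrating factor. *)
Lemma delay_solution_middle z f y y2 : delay_supported f ->
  delay_solution z f y y2 -> (forall x, x \in `[0, a] -> y2 x = expf (- z) x) ->
  forall x, 0 <= x -> x <= 2 * a -> x <= pi ->
  y x = expf z x * (1 + cint mu `]a, x] (fun s => f s * expf z (a - 2 * s))).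
Proof.
move=> Df sol y2E x x0 x2a xpi.
have yE := delay_solution_initial Df sol; have [fi fs] := Df.
have [xa|ax] := leP x a.
  rewrite yE ?in_itv /= ?x0 // set_itv_ge ?bnd_simp -?leNgt //.
  rewrite (_ : cint _ _ _ = 0) ?addr0 ?mulr1 //.
  by apply: complex_eq; rewrite /cint /= Rintegral_set0.
have [acy _ dy] := sol.
pose h t := f t * expf z (a - t).
have hs t : h t != 0 -> a < t < pi.
  by move=> h0; apply: fs; apply: contraNneq h0 => f0; rewrite /h f0 mul0r.
have hi : cintegrable mu setT h.
  apply: (@delay_supported_cintegrableM _ _ (fun t => a - t)) => //.
  - exact: ccont_expf.
  - exact: measurable_funB.
  - by move=> t /andP[ta tp]; rewrite ler_norml; apply/andP; have := a_gt0; split; lra.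
have dx : {ae mu, forall t, t \in `]a, x[ -> is_deriveC t y (z * y t + h t)}.
  apply: filterS (ae_itv_sub (ltW a_gt0) xpi dy).
    exact: (ae_filter_ringOfSetsType mu).
  move=> t + tx => /(_ tx); rewrite y2E ?expfN ?opprB //.
  by move: tx; rewrite !in_itv /= => /andP[t1 t2]; apply/andP; split; lra.
have hb t : h t != 0 -> `|t| <= pi.
  by move=> /hs /andP[h1 h2]; rewrite ger0_norm ?ltW //; apply: lt_trans h1.
have acx : abs_continuousC a x y by apply: abs_continuousC_sub acy => //; exact: ltW.
have := variation_of_constants (ltW ax) acx hi hb dx.
have ya : y a = expf z a by apply: yE; rewrite in_itv /= lexx ltW.
rewrite ya !expfN -expfD addNr expf0 => /eqP; rewrite subr_eq addrC => /eqP E.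
rewrite -[LHS](expfK z x) E; congr (_ * (_ + _)).
apply: eq_cint => t _; rewrite /h -mulrA expfN -expfD; congr (_ * expf _ _); ring.
Qed.

Definition double_kernel (f g : R -> C) (p : R * R) : C :=
  f p.1 * g p.2 * (if p.2 <= p.1 - a then 1 else 0).

Lemma double_kernel_neq0 f g p : delay_supported f -> delay_supported g ->
  double_kernel f g p != 0 -> [/\ a < p.2, p.2 <= p.1 - a & p.1 < pi].
Proof.
move=> [_ fs] [_ gs]; rewrite /double_kernel; case: ifP => [le|_]; last first.
  by rewrite mulr0 eqxx.
by rewrite mulr1 mulf_eq0 negb_or => /andP[/fs/andP[_ h] /gs/andP[h' _]].
Qed.

Lemma double_kernel_cintegrable f g : delay_supported f -> delay_supported g ->
  cintegrable (mu \x mu)%E setT (double_kernel f g).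
Proof.
move=> [fi _] [gi _].
apply: (cintegrableM_bounded measurableT (cintegrable_tensor fi gi) (M := 1)).
  split.
    rewrite (_ : (fun p => _) = fun p : R * R => if p.2 <= p.1 - a then 1 else 0 : R).
      have m2 : measurable_fun setT (fun p : R * R => p.2) by exact: measurable_snd.
      have m1 : measurable_fun setT (fun p : R * R => p.1 - a).
        by apply: measurable_funB => //; exact: measurable_fst.
      by apply: measurable_fun_ifT => //; exact: measurable_fun_ler.
    by apply/funext => p; case: ifP.
  rewrite (_ : (fun p => _) = cst 0) //.
  by apply/funext => p; case: ifP.
by move=> p _ _; case: ifP => _; rewrite ?Normc.normc1 ?Normc.normc0.
Qed.

(* The two terms of the Neumann series that are linear and quadratic in the
   potential; since [pi <= 3 a], there are no others. *)
Definition delay_functional (f g : R -> C) (phi : R -> C) : C :=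
  kernel_functional mu f (fun t => pi + a - 2 * t) phi +
  kernel_functional (mu \x mu)%E (double_kernel f g)
    (fun p => pi - 2 * (p.1 - p.2)) phi.

Lemma measurable_double_phase :
  measurable_fun setT (fun p : R * R => pi - 2 * (p.1 - p.2)).
Proof.
apply: measurable_funB => //; apply: measurable_funM => //.
by apply: measurable_funB; [exact: measurable_fst|exact: measurable_snd].
Qed.

(** The support even gives the bound [pi - 2 a]; [pi - a] is chosen to share one interval with the
    single integral. *)
Lemma double_kernel_phase f g p : delay_supported f -> delay_supported g ->
  double_kernel f g p != 0 -> `|pi - 2 * (p.1 - p.2)| <= pi - a.
Proof.
move=> Df Dg /(double_kernel_neq0 Df Dg)[h1 h2 h3].
by rewrite ler_norml; apply/andP; have := a_gt0; split; lra.
Qed.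

Lemma single_phase f t : delay_supported f -> f t != 0 ->
  `|pi + a - 2 * t| <= pi - a.
Proof.
move=> [_ fs] /fs/andP[h1 h2].
by rewrite ler_norml; apply/andP; have := a_gt0; split; lra.
Qed.

Lemma single_phase_measurable : measurable_fun setT (fun t : R => pi + a - 2 * t).
Proof. by apply: measurable_funB => //; exact: measurable_funM. Qed.

Let tail_cintegrable (g : R -> C) (z : C) (t : R) : delay_supported g ->
  cintegrable mu setT
    (fun s => g s * ((if s <= t - a then 1 else 0) * expf z (a - 2 * s))).
Proof.
move=> [gi gs]; have [M HM] := ccont_bounded (3 * pi) (ccont_expf z).
apply: (cintegrableM_bounded measurableT gi (M := `|M|)).
  apply: cmeasurableM.
    split.
      rewrite (_ : (fun p => _) = fun s : R => if s <= t - a then 1 else 0 : R).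
        by apply: measurable_fun_ifT => //; exact: measurable_fun_ler.
      by apply/funext => p; case: ifP.
    rewrite (_ : (fun p => _) = cst 0) //.
    by apply/funext => p; case: ifP.
  apply: (@ccont_cmeasurable _ _ _ (fun s : R => a - 2 * s) _ _ (ccont_expf z)).
  by apply: measurable_funB => //; exact: measurable_funM.
move=> s _ /gs /andP[s1 s2]; case: ifP => _; last by rewrite mul0r Normc.normc0.
rewrite mul1r; apply: le_trans (HM _ _) (ler_norm M).
by rewrite ler_norml; apply/andP; have := a_gt0; split; lra.
Qed.

(** For [t <= pi] the argument [t - a] stays within [2 a], where [delay_solution_middle] makes [y2]
    explicit. One more variation of constants, followed by Fubini, produces the two terms. *)
Theorem delay_solution_pi z f g y y2 : delay_supported f -> delay_supported g ->
  delay_solution z f y y2 -> delay_solution (- z) g y2 y ->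
  y pi = expf z pi + delay_functional f g (expf z).
Proof.
move=> Df Dg sol sol2; have [fi fs] := Df; have [gi gs] := Dg.
have yE := delay_solution_initial Df sol.
have y2E : forall x, 0 <= x -> x <= 2 * a -> x <= pi -> y2 x =
    expf (- z) x * (1 + cint mu `]a, x] (fun s => g s * expf (- z) (a - 2 * s))).
  by apply: (delay_solution_middle Dg sol2) => x; rewrite opprK; exact: yE.
pose A t := f t * expf z (pi + a - 2 * t).
pose K p := double_kernel f g p * expf z (pi - 2 * (p.1 - p.2)).
pose G t s := g s * ((if s <= t - a then 1 else 0) * expf (- z) (a - 2 * s)).
pose B t := cint mu setT (fun s => K (t, s)).
have GE t : cint mu `]a, t - a] (fun s => g s * expf (- z) (a - 2 * s)) =
    cint mu setT (G t).
  rewrite cint_mkcond; apply: eq_cint => s _; rewrite /G.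
  have [->|/gs/andP[s1 s2]] := eqVneq (g s) 0; first by rewrite !mul0r; case: ifP.
  case: ifP => [|sn].
    by rewrite inE /= in_itv /= => /andP[_ ->]; rewrite mul1r.
  case: ifP => // st; last by rewrite mul0r mulr0.
  by move: sn; rewrite mem_set //= in_itv /= s1.
have KE t : (fun s => K (t, s)) = (fun s => A t * G t s).
  apply/funext => s; rewrite /K /A /G /double_kernel /=.
  (* The phase of the double integral is that of the single one minus the phase [a - 2 s] of [y2],
     so the integrand factors as [A t * G t s]. *)
  rewrite (_ : pi - 2 * (t - s) = (pi + a - 2 * t) + - (a - 2 * s)); last by ring.
  by rewrite expfD expfN; case: ifP => _; ring.
have Gi t : cintegrable mu setT (G t) by exact: tail_cintegrable.
have Kxi t : cintegrable mu setT (fun s => K (t, s)).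
  by rewrite KE; apply: cintegrableZ.
have BE t : B t = A t * cint mu setT (G t).
  by rewrite /B KE cintZ.
have [M HM] := ccont_bounded (pi - a) (ccont_expf z).
have Ki : cintegrable (mu \x mu)%E setT K.
  apply: (cintegrableM_bounded measurableT (double_kernel_cintegrable Df Dg) (M := M)).
    exact: (ccont_cmeasurable measurable_double_phase (ccont_expf z)).
  by move=> p _ /(double_kernel_phase Df Dg); exact: HM.
have Ai : cintegrable mu setT A.
  apply: (cintegrableM_bounded measurableT fi (M := M)).
    exact: (ccont_cmeasurable single_phase_measurable (ccont_expf z)).
  by move=> t _ /(single_phase Df); exact: HM.
have [Bi KB] := cint_fubini Ki Kxi.
have -> : delay_functional f g (expf z) = cint mu setT (fun t => A t + B t).
  by rewrite cintD // -/(B _); congr (_ + _); exact: KB.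
have AB0 t : A t + B t != 0 -> a < t < pi.
  move=> h; apply: fs; apply: contraNneq h => f0.
  by rewrite BE /A f0 !mul0r addr0.
(* [A] and [B] already contain the propagation from [t] to [pi]; the factor [e^(z (t - pi))] undoes
   it and leaves the source term [f t * y2 (t - a)]. *)
pose h t := (A t + B t) * expf z (t - pi).
have hs t : h t != 0 -> a < t < pi.
  by move=> h0; apply: AB0; apply: contraNneq h0 => f0; rewrite /h f0 mul0r.
have hi : cintegrable mu setT h.
  apply: (@delay_supported_cintegrableM _ _ (fun t => t - pi)) => //.
  - by split => //; exact: cintegrableD.
  - exact: ccont_expf.
  - exact: measurable_funB.
  - by move=> t /andP[ta tp]; rewrite ler_norml; apply/andP; have := a_gt0; split; lra.
have [acy _ dy] := sol.
have dx : {ae mu, forall t, t \in `]a, pi[ -> is_deriveC t y (z * y t + h t)}.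
  apply: filterS (ae_itv_sub (ltW a_gt0) (lexx pi) dy).
    exact: (ae_filter_ringOfSetsType mu).
  move=> t + tp => /(_ tp); move: (tp); rewrite !in_itv /= => /andP[t1 t2].
  rewrite y2E; [|by have := a_gt0; have := pi_le_3a; lra..].
  rewrite GE /h BE /A.
  move=> H; apply: is_deriveC_eq H _; congr (_ + _).
  rewrite (_ : expf (- z) (t - a) = expf z (pi + a - 2 * t) * expf z (t - pi)).
    ring.
  by rewrite -expfD expfN; congr expf; ring.
have hb t : h t != 0 -> `|t| <= pi.
  by move=> /hs /andP[h1 h2]; rewrite ger0_norm ?ltW //; apply: lt_trans h1.
have acx : abs_continuousC a pi y by apply: abs_continuousC_sub acy => //; exact: ltW.
have := variation_of_constants (ltW a_lt_pi) acx hi hb dx.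
have ya : y a = expf z a by apply: yE; rewrite in_itv /= lexx ltW.
rewrite ya !expfN -expfD addNr expf0 => /eqP; rewrite subr_eq addrC => /eqP E.
rewrite -[LHS](expfK z pi) E mulrDr mulr1; congr (_ + _).
rewrite cint_delay_supported; last first.
  move=> t ht; have /hs/andP[t1 t2] : h t != 0.
    by apply: contraNneq ht => ->; rewrite mul0r.
  by rewrite t1 ltW.
rewrite -(cintZ measurableT); last first.
  have : cintegrable mu setT (fun t => expf z (- pi) * (A t + B t)).
    by apply: cintegrableZ => //; exact: cintegrableD.
  rewrite (_ : (fun t => _ * _) = (fun t => h t * expf (- z) t)) //.
  apply/funext => t; rewrite /h -mulrA expfN -expfD mulrC; congr (_ * expf _ _); ring.
apply: eq_cint => t _; rewrite /h expfN -mulrA -expfD mulrCA -expfD.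
by rewrite (_ : pi + _ = 0) ?expf0 ?mulr1 //; ring.
Qed.

End DelaySystem.

(** * Spectra *)

Section PiBound.
Context {R : realType}.

Lemma le_of_is_derive (F G f g : R -> R) (x : R) : 0 <= x -> F 0 = G 0 ->
  (forall t, is_derive t (1 : R) F (f t)) -> (forall t, is_derive t (1 : R) G (g t)) ->
  (forall t, 0 <= t -> f t <= g t) -> F x <= G x.
Proof.
move=> x0 FG0 dF dG fg.
have d t : is_derive t (1 : R) (G - F) (g t - f t) by exact: is_deriveB.
have H t : t \in `[0, x] -> 0 <= g t - f t.
  by rewrite in_itv /= => /andP[t0 _]; rewrite subr_ge0 fg.
have := nondecreasing_is_derive x0 (fun t _ => d t) H.
by rewrite !fctE FG0 subrr subr_ge0.
Qed.

Lemma is_derive_monomial n (c t : R) :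
  is_derive t (1 : R) (fun x : R => c * x ^+ n.+1) (c * n.+1%:R * t ^+ n).
Proof.
rewrite (_ : (fun x => _) = c *: (@id R ^+ n.+1)); last first.
  by apply/funext => x; rewrite !fctE.
by apply: is_derive_eq; rewrite /GRing.scale /= mulr1 mulrA.
Qed.

(** The inequality [cos <= 1] integrated four times from 0. *)
Lemma cos_le_taylor4 (x : R) : 0 <= x -> cos x <= 1 - 2^-1 * x ^+ 2 + 24^-1 * x ^+ 4.
Proof.
have s1 (y : R) : 0 <= y -> sin y <= y.
  move=> y0; have := @le_of_is_derive (@sin R) (fun t => t) (@cos R) (fun=> 1) y y0; apply.
  - by rewrite sin0.
  - by move=> t _; exact: cos_le1.
have c2 (y : R) : 0 <= y -> 1 - 2^-1 * y ^+ 2 <= cos y.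
  move=> y0; apply: (@le_of_is_derive (fun t => 1 - 2^-1 * t ^+ 2) cos (fun t => - t)
    (fun t => - sin t) y y0).
  - by rewrite cos0 expr0n mulr0 subr0.
  - move=> t; have h := is_derive_monomial 1 (2^-1) t.
    rewrite (_ : (fun _ => _) = cst 1 - (fun x : R => 2^-1 * x ^+ 2)); last by [].
    by apply: is_derive_eq; rewrite sub0r mulVf ?mul1r // pnatr_eq0.
  - by move=> t t0; rewrite lerN2 s1.
have s3 (y : R) : 0 <= y -> y - 6^-1 * y ^+ 3 <= sin y.
  move=> y0; apply: (@le_of_is_derive (fun t => t - 6^-1 * t ^+ 3) sin
    (fun t => 1 - 2^-1 * t ^+ 2) cos y y0).
  - by rewrite sin0 expr0n mulr0 subr0.
  - move=> t; have h := is_derive_monomial 2 (6^-1) t.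
    rewrite (_ : (fun _ => _) = id - (fun x : R => 6^-1 * x ^+ 3)); last by [].
    by apply: is_derive_eq; field.
  - exact: c2.
move=> x0; apply: (@le_of_is_derive cos (fun t => 1 - 2^-1 * t ^+ 2 + 24^-1 * t ^+ 4)
    (fun t => - sin t) (fun t => - (t - 6^-1 * t ^+ 3)) x x0).
- by rewrite cos0 !expr0n !mulr0 subr0 addr0.
- move=> t; have h := is_derive_monomial 1 (2^-1) t.
  have h' := is_derive_monomial 3 (24^-1) t.
  rewrite (_ : (fun _ => _) = cst 1 - (fun x : R => 2^-1 * x ^+ 2) +
    (fun x : R => 24^-1 * x ^+ 4)); last by [].
  by apply: is_derive_eq; field.
- by move=> t t0; rewrite lerN2 s3.
Qed.

(** This is [3 pi / 5 < 2]. If [10 / 3 <= pi], then [5 / 3 <= pi / 2] and [cos (5 / 3) >= 0],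
    whereas the Taylor bound at [5 / 3] is negative. *)
Lemma pi_lt_10_3 : 3 * pi < 10 :> R.
Proof.
rewrite ltNge; apply/negP => h.
have c1 : cos (5 / 3 : R) <= 1 - 2^-1 * (5 / 3) ^+ 2 + 24^-1 * (5 / 3) ^+ 4.
  by apply: cos_le_taylor4; lra.
have c2 : 0 <= cos (5 / 3 : R) by apply: cos_ge0_pihalf; apply/andP; split; lra.
lra.
Qed.

End PiBound.

(** * Integrability of the entries, local bounds at zeros, enumeration of the spectrum *)

Section SpectralData.
Context {R : realType}.
Local Notation C := (R[i]).
Local Notation mu := (@lebesgue_measure R).

Lemma square_cintegrable d (T : measurableType d) (nu : {measure set T -> \bar R})
    (D : set T) (f : T -> C) : measurable D -> cmeasurable D f ->
  nu.-integrable D (EFin \o (fun=> 1 : R)) ->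
  nu.-integrable D (EFin \o (fun x => Normc.normc (f x) ^+ 2)) ->
  cintegrable nu D f.
Proof.
move=> mD mf i1 i2; apply: (cintegrable_le (g := fun x => 1 + Normc.normc (f x) ^+ 2) mD mf).
  exact: (integrableD mD i1 i2).
move=> x _ /=.
by have := normc_ge0 (f x); nra.
Qed.

Lemma L2_cintegrable (A B : R) (f : R -> C) :
  L2 `]A, B[%classic f -> cintegrable mu `]A, B[ f.
Proof.
move=> [m1 m2 fin].
have mD : measurable (`]A, B[ : set R) by exact: measurable_itv.
have mf : cmeasurable `]A, B[%classic f by split.
have mn := cmeasurable_normc mD mf.
have i2 : mu.-integrable `]A, B[ (EFin \o (fun x => Normc.normc (f x) ^+ 2)).
  apply/integrableP; split; first by apply/measurable_EFinP; exact: measurable_funX.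
  rewrite [ltLHS](_ : _ = \int[mu]_(x in `]A, B[) (Normc.normc (f x) ^+ 2)%:E)%E //.
  by apply: eq_integral => x _ /=; rewrite ger0_norm ?sqr_ge0.
have i1 : mu.-integrable `]A, B[ (EFin \o (fun=> 1 : R)).
  have i1 : mu.-integrable `[A, B] (EFin \o (fun=> 1 : R)).
    apply: continuous_compact_integrable; first exact: segment_compact.
    by apply: continuous_subspaceT => x; exact: cvg_cst.
  by apply: integrableS i1 => //; exact: subset_itv_oo_cc.
exact: square_cintegrable.
Qed.

Lemma normr_complex (z : C) : `|z| = (Normc.normc z)%:C.
Proof. by case: z. Qed.

(** Continuity bounds [g] by [1 + |g z|] near [z]. In the order of complex numbers a positive radius
    is real, so its real part serves as [d]. *)
Lemma zero_order_bounded (g : C -> C) (z : C) :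
  derivable (g : C^o -> C^o) z 1 ->
  exists d B : R, 0 < d /\ forall w, Normc.normc (w - z) < d -> Normc.normc (g w) <= B.
Proof.
move=> /derivable1_diffP /differentiable_continuous cg.
have /cvgrPdist_lt := cg => /(_ 1 ltr01) /nbhs_ballP[e /= e0 H].
exists (complex.Re e), (1 + Normc.normc (g z)); move: e0; rewrite ltcE /= => /andP[/eqP ime re].
split => // w wz.
have /H : ball (z : C^o) e (w : C^o).
  rewrite /ball /= normr_complex ltcE /= ime eqxx /=.
  by rewrite -normc_opp opprB.
rewrite /= normr_complex ltcE /= => /andP[_ gzw].
have := normcD (g w - g z) (g z); rewrite subrK -(normc_opp (_ - _)) opprB; lra.
Qed.

(** Runs through [0, -1, 1, -2, 2, ...]. Alternating signs keep [|nat_int n|] near [n / 2], from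
    which the condition [b < 2] arises. *)
Definition nat_int (n : nat) : int := if odd n then Negz n./2 else Posz n./2.

Lemma nat_int_inj : injective nat_int.
Proof.
move=> m n; rewrite /nat_int; case: ifP => om; case: ifP => on // [e];
  by rewrite -(odd_double_half m) -(odd_double_half n) om on e.
Qed.

Lemma nat_int_bound n : `|(nat_int n)%:~R : R| <= n%:R / 2 + 1.
Proof.
have h : ((n./2)%:R : R) <= n%:R / 2.
  by rewrite ler_pdivlMr // -natrM ler_nat muln2 -{2}(odd_double_half n) leq_addl.
rewrite /nat_int; case: ifP => _.
  by rewrite NegzE mulrNz normrN -pmulrn ger0_norm // -(natr1 n./2); lra.
by rewrite -pmulrn ger0_norm //; lra.
Qed.

(** [nat_int] is injective, so the repetitions among the first [n + 1] nodes inject into the index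
    set of that value, which has [m] elements. *)
Lemma count_le_card (T : choiceType) (lam : int -> T) (n m : nat) :
  ([set k | lam k = lam (nat_int n)] #= `I_m)%card ->
  (count (fun j => lam (nat_int j) == lam (nat_int n)) (iota 0 n.+1) <= m)%N.
Proof.
move=> /card_set_bijP[f [fI finj _]].
rewrite -size_filter -(size_map (f \o nat_int)) -[leqRHS](size_iota 0 m).
apply: uniq_leq_size.
  rewrite map_inj_in_uniq; first by rewrite filter_uniq // iota_uniq.
  move=> i j; rewrite !mem_filter => /andP[/eqP ei _] /andP[/eqP ej _] /= fij.
  by apply: nat_int_inj; apply: finj; rewrite ?inE.
move=> k /mapP[j]; rewrite mem_filter => /andP[/eqP ej _] ->.
by rewrite mem_iota add0n; exact: (fI (nat_int j)).
Qed.

(** A single square is at most the whole sum, and [k <= 1 + k^2]. *)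
Lemma summable_bounded (k : int -> R) : (forall n, 0 <= k n) ->
  summable [set: int] (fun n => (k n ^+ 2)%:E) -> exists M, forall n, k n <= M.
Proof.
move=> k0 sk.
have H n : ((k n ^+ 2)%:E <= \esum_(x in [set: int]) `|(k x ^+ 2)%:E|)%E.
  apply: esum_ge; exists [set n]; first by split.
  by rewrite fsbig_set1 /= lee_fin ler_norm.
pose S := (\esum_(x in [set: int]) `|(k x ^+ 2)%:E|)%E.
have Sf : S \is a fin_num.
  by rewrite ge0_fin_numE //; apply: esum_ge0 => x _; exact: abse_ge0.
exists (1 + fine S) => n; have := H n; rewrite -/S -(fineK Sf) lee_fin.
by have := k0 n; nra.
Qed.

End SpectralData.

(** * From the matrix system to the scalar delay system *)

Section SystemReduction.
Context {R : realType}.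
Local Notation C := (R[i]).
Local Notation mu := (@lebesgue_measure R).

Lemma mulii : 'i%C * 'i%C = -1 :> C.
Proof. by rewrite -expr2 sqr_i. Qed.

Lemma normc_i : Normc.normc ('i%C : C) = 1.
Proof. by rewrite normc_sqrt /= expr0n add0r expr1n sqrtr1. Qed.

Lemma integrable_extend0 d (T : measurableType d) (nu : {measure set T -> \bar R})
    (D : set T) (h k : T -> R) : measurable D ->
  (forall x, k x = if x \in D then h x else 0) ->
  nu.-integrable D (EFin \o h) -> nu.-integrable setT (EFin \o k).
Proof.
move=> mD kE /(integrable_mkcond _ mD); apply: eq_integrable => // x _.
by rewrite patchE /= kE; case: ifP.
Qed.

Lemma cintegrable_extend0 (a : R) (f : R -> C) : 0 < a ->
  cintegrable mu `]0, pi[ f ->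
  cintegrable mu setT (fun x => if a < x < pi then f x else 0).
Proof.
move=> a0.
have E (h : R -> R) (k : R -> R) : (forall x, k x = if a < x < pi then h x else 0) ->
    mu.-integrable `]0, pi[ (EFin \o h) -> mu.-integrable setT (EFin \o k).
  move=> kE hi.
  have : mu.-integrable `]a, pi[ (EFin \o h).
    apply: integrableS hi => //; apply: subset_itvr; rewrite bnd_simp; exact: ltW.
  apply: integrable_extend0 => // x; rewrite kE.
  rewrite (_ : (x \in `]a, pi[%classic) = (a < x < pi)) //.
  by apply/idP/idP; rewrite inE /= in_itv.
move=> [f1 f2]; split.
  by apply: E f1 => x; case: ifP.
by apply: E f2 => x; case: ifP.
Qed.

(** This is [f] for [c = - 'i] and [g] for [c = 'i]. The cut-off turns the almost everywhere
    condition on [(0, a)] into exact support. *)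
Definition delay_potential (a : R) (c : C) (p q : R -> C) (x : R) : C :=
  if a < x < pi then p x + c * q x else 0.

Lemma delay_potential_supported a c q p : 0 < a -> admissible a q p ->
  delay_supported a (delay_potential a c p q).
Proof.
move=> a0 [/L2_cintegrable qi /L2_cintegrable pi' _]; split.
  apply: cintegrable_extend0 => //.
  apply: (cintegrableD _ pi' (cintegrableZ _ _ qi)); exact: measurable_itv.
by move=> x; rewrite /delay_potential; case: ifP; rewrite ?eqxx.
Qed.

Lemma idx1E : idx 1 = ord0. Proof. by apply: val_inj; rewrite /= inordK. Qed.
Lemma idx2E : idx 2 = lift ord0 ord0.
Proof. by apply: val_inj; rewrite /= inordK. Qed.

(* With [c = +- 'i], the combination [y1 + c y2] diagonalizes [B]. *)
Definition combination (c : C) (y : R -> 'M[C]_2) (x : R) : C :=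
  y x (idx 1) (idx 1) + c * y x (idx 2) (idx 1).

Lemma abs_continuousCD A B (f g : R -> C) :
  abs_continuousC A B f -> abs_continuousC A B g ->
  abs_continuousC A B (fun x => f x + g x).
Proof.
move=> [f1 f2] [g1 g2]; split.
  rewrite (_ : (fun x => _) = fun x => complex.Re (f x) + complex.Re (g x)).
    exact: abs_continuousD.
  by apply/funext => x; rewrite Re_add.
rewrite (_ : (fun x => _) = fun x => complex.Im (f x) + complex.Im (g x)).
  exact: abs_continuousD.
by apply/funext => x; rewrite Im_add.
Qed.

Lemma abs_continuousC_cst A B (c : C) : abs_continuousC A B (fun=> c).
Proof.
apply: (@abs_continuousC_is_derive _ _ _ _ (fun=> 0)).
  by move=> x; exact: is_deriveC_cst.
exact: ccont_cst.
Qed.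

Lemma system_delay_solution a q p l (y : R -> 'M[C]_2) (c : C) :
  c * c = -1 -> 0 < a -> admissible a q p -> solution a q p l y -> y 0 = 1%:M ->
  delay_solution a (c * l) (delay_potential a (- c) p q)
    (combination c y) (combination (- c) y).
Proof.
move=> cc a0 [_ _ Q0] [acy dy] y0; split.
- apply: abs_continuousCD; first exact: acy.
  by apply: abs_continuousCM; [exact: abs_continuousC_cst|exact: acy].
- by rewrite /combination y0 !mxE idx1E idx2E /= mulr0 addr0.
(* At [x = a] the cut-off potential is 0 while [Qmx] may differ from 0; this one point is
   discarded. *)
have dy' : {ae mu, forall x, x \in `]0, pi[ -> (x \in `]0, a[ -> Qmx q p x = 0) /\ x <> a /\
    exists2 dy : 'M[C]_2, (forall i j, is_deriveC x (fun t => y t i j) (dy i j)) &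
      Bmx *m dy + Qmx q p x *m y (x - a) = l *: y x}.
  have na := ae_neq a; move: Q0 na dy => Q0 na; apply: filterS3 Q0 na.
    exact: (ae_filter_ringOfSetsType mu).
  by move=> x h1 h2 h3 xpi; split; [|split; [|exact: h3]].
apply: filterS dy'; first exact: (ae_filter_ringOfSetsType mu).
move=> x + xpi => /(_ xpi)[Q0x [xa [d dE sys]]].
have := is_deriveCD (dE (idx 1) (idx 1)) (is_deriveCZ c (dE (idx 2) (idx 1))).
move=> H; apply: is_deriveC_eq H _.
have e0 := congr1 (fun m : 'M[C]_2 => m (idx 1) (idx 1)) sys.
have e1 := congr1 (fun m : 'M[C]_2 => m (idx 2) (idx 1)) sys.
move: e0 e1; rewrite !mxE !big_ord_recl !big_ord0 !mxE /= idx1E idx2E /= !addr0.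
rewrite !mul0r !mul1r !add0r !mulN1r !addr0 => e0 e1.
rewrite /combination idx1E idx2E.
set o1 := lift ord0 ord0 in e0 e1 *.
have d1 : d o1 ord0 = l * y x ord0 ord0 -
    (q x * y (x - a) ord0 ord0 + p x * y (x - a) o1 ord0) by rewrite -e0 addrK.
have d0 : d ord0 ord0 = (p x * y (x - a) ord0 ord0 - q x * y (x - a) o1 ord0) -
    l * y x o1 ord0 by rewrite -e1; ring.
have key (F : C) : F * (y (x - a) ord0 ord0 + - c * y (x - a) o1 ord0) =
    (p x - c * q x) * (y (x - a) ord0 ord0 - c * y (x - a) o1 ord0) ->
  d ord0 ord0 + c * d o1 ord0 =
    c * l * (y x ord0 ord0 + c * y x o1 ord0) +
    F * (y (x - a) ord0 ord0 + - c * y (x - a) o1 ord0).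
  move=> ->; rewrite d0 d1; apply/eqP; rewrite eq_sym -subr_eq0.
  (* The two sides agree only modulo [c * c = -1], and the defect is an explicit multiple of
     [c * c + 1]. *)
  rewrite (_ : _ - _ = (c * c + 1) * (l * y x o1 ord0 + q x * y (x - a) o1 ord0)).
    by rewrite cc addNr mul0r.
  ring.
apply: key; rewrite /delay_potential.
move: xpi; rewrite in_itv /= => /andP[x0 xpi]; rewrite xpi andbT.
have [ax|ax|] := ltgtP a x.
- by rewrite !mulNr.
- have := Q0x; rewrite in_itv /= x0 ax => /(_ isT) Qx0.
  have qx : q x = 0.
    by have := congr1 (fun m : 'M[C]_2 => m ord0 ord0) Qx0; rewrite !mxE.
  have px : p x = 0.
    by have := congr1 (fun m : 'M[C]_2 => m ord0 o1) Qx0; rewrite !mxE.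
  by rewrite qx px mulr0 subrr !mul0r.
- by move=> ax; case: xa.
Qed.

End SystemReduction.

(** * From a common spectrum to a vanishing functional *)

Section SpectralUniqueness.
Context {R : realType}.
Local Notation C := (R[i]).
Local Notation mu := (@lebesgue_measure R).

(** A factor [(l - z)^m] common to both functions divides their difference; the substitution
    [l = - i w] moves the zero to [i z] and produces the constant [(- i)^m]. The order of the
    difference may be higher, hence [vanishes]. *)
Lemma zero_order_vanishes (D1 D2 : C -> C) (kappa z : C) (m : nat) (D : C -> C) :
  zero_order D1 z m -> zero_order D2 z m ->
  (forall w, D w = kappa * (D1 (- 'i%C * w) - D2 (- 'i%C * w))) ->
  vanishes D ('i%C * z) m.
Proof.
move=> [g1 [dg1 _ E1]] [g2 [dg2 _ E2]] DE.
have [d1 [B1 [d10 H1]]] := zero_order_bounded (dg1 z).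
have [d2 [B2 [d20 H2]]] := zero_order_bounded (dg2 z).
exists (fun w => kappa * (- 'i%C) ^+ m * ((g1 : C -> C) (- 'i%C * w) - (g2 : C -> C) (- 'i%C * w))).
have shift w : - 'i%C * w - z = - 'i%C * (w - 'i%C * z).
  rewrite (_ : - 'i%C * (w - 'i%C * z) = - 'i%C * w + ('i%C * 'i%C) * z); last by ring.
  by rewrite mulii mulN1r.
split.
  by move=> w; rewrite DE E1 E2 shift exprMn; ring.
exists (Num.min d1 d2), (Normc.normc (kappa * (- 'i%C) ^+ m) * (B1 + B2)).
split; first by rewrite lt_min d10.
have nN w : Normc.normc (- 'i%C * w - z) = Normc.normc (w - 'i%C * z).
  by rewrite shift Normc.normcM normc_opp normc_i mul1r.
move=> w; rewrite -nN lt_min => /andP[w1 w2].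
rewrite Normc.normcM ler_wpM2l ?normc_ge0 //.
apply: le_trans (normcD _ _) _; rewrite normc_opp lerD //; [exact: H1|exact: H2].
Qed.

(** With [w = i l] the zeros become the nodes [i lam n]: their moduli grow like [|n|], and their
    real parts [- Im (lam n)] stay bounded since [lam n] is within a bounded distance of [n]. *)
Lemma functional_eq0_of_spectrum b (M : (R -> C) -> C) (D1 D2 : C -> C)
    (kappa c : C) (lam : int -> C) :
  0 <= b -> b < 2 -> bounded_functional b M ->
  (forall l, M (expf ('i%C * l)) = kappa * (D1 l - D2 l)) ->
  (forall z, exists2 m, zero_order D1 z m & ([set n | lam n = z] #= `I_m)%card) ->
  (forall z, exists2 m, zero_order D2 z m & ([set n | lam n = z] #= `I_m)%card) ->
  summable [set: int] (fun n => ((Normc.normc (lam n - (n%:~R + c))) ^+ 2)%:E) ->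
  forall w, M (expf w) = 0.
Proof.
move=> b0 b2 HM ME Z1 Z2 /(summable_bounded (fun n => normc_ge0 _))[K HK].
have iK (w : C) : 'i%C * (- 'i%C * w) = w.
  by rewrite mulrA mulrN mulii opprK mul1r.
pose zs n := 'i%C * lam (nat_int n).
have DE w : M (expf w) = kappa * (D1 (- 'i%C * w) - D2 (- 'i%C * w)).
  by rewrite -ME iK.
apply: (@functional_eq0_of_zeros R b M zs b0 HM _ (K + Normc.normc c + 1) b2).
- move=> n; have [m Z1m cm] := Z1 (lam (nat_int n)).
  have [m' Z2m cm'] := Z2 (lam (nat_int n)).
  (* Both orders are the cardinality of the same index set, because one [lam] lists both spectra. *)
  have mm : m' = m by apply/card_eq_II; apply: card_eq_trans cm; rewrite card_eq_sym.
  rewrite {}mm in Z2m.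
  exists m; last exact: zero_order_vanishes Z1m Z2m DE.
  apply: leq_trans (count_le_card cm); rewrite leq_eqVlt; apply/orP; left; apply/eqP.
  apply: eq_count => j; rewrite /zs; apply/eqP/eqP => [|->] //.
  apply: mulfI; apply/eqP => h; have := normc_i (R := R).
  by rewrite h Normc.normc0 => /eqP; rewrite eq_sym oner_eq0.
- move=> n; rewrite /zs Normc.normcM normc_i mul1r.
  set k := nat_int n.
  have := normcD (lam k - (k%:~R + c)) (k%:~R + c); rewrite subrK.
  have := normcD (k%:~R) c; have := HK k.
  have -> : Normc.normc (k%:~R : C) = `|k%:~R : R|.
    by rewrite -(rmorph_int (real_complex R)) normc_real.
  have := @nat_int_bound R n; rewrite -/k; lra.
- move=> n; rewrite /zs; set k := nat_int n.
  rewrite Re_mul /= mul0r mul1r sub0r normrN.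
  have E : complex.Im (lam k) = complex.Im (lam k - (k%:~R + c)) + complex.Im c.
    rewrite !(Im_add, Im_opp) -(rmorph_int (real_complex R)) /=; ring.
  rewrite E; apply: le_trans (ler_normD _ _) _.
  have := normc_Im (lam k - (k%:~R + c)); have := HK k; have := normc_Im c; lra.
Qed.

Lemma bounded_functional_reflect b (L : (R -> C) -> C) : bounded_functional b L ->
  bounded_functional b (fun phi => L (fun x => phi (- x))).
Proof.
move=> [l [K K0 H]]; split.
  by move=> c f g cf cg; rewrite (l c (fun x => f (- x))) //; exact: ccont_reflect.
exists K => // f M cf fM; apply: H; first exact: ccont_reflect.
by move=> x xb; apply: fM; rewrite normrN.
Qed.

Lemma kernel_functional_continuous d (T : measurableType d)
    (nu : {measure set T -> \bar R}) (k : T -> C) (theta : T -> R) b :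
  cintegrable nu setT k -> measurable_fun setT theta ->
  (forall x, k x != 0 -> `|theta x| <= b) ->
  continuous_functional b (kernel_functional nu k theta).
Proof.
move=> ki mt tb; split; first exact: kernel_functional_bounded.
by move=> phi_ phi M m1 m2 H cv; have := kernel_functional_cvg ki mt tb m1 m2 H cv.
Qed.

Lemma kernel_functionalB d (T : measurableType d)
    (nu : {measure set T -> \bar R}) (k k' : T -> C) (theta : T -> R) b phi :
  cintegrable nu setT k -> cintegrable nu setT k' -> measurable_fun setT theta ->
  (forall x, k x != 0 -> `|theta x| <= b) ->
  (forall x, k' x != 0 -> `|theta x| <= b) -> ccont phi ->
  kernel_functional nu (fun x => k x + -1 * k' x) theta phi =
  kernel_functional nu k theta phi - kernel_functional nu k' theta phi.
Proof.
move=> ki ki' mt tb tb' cphi; have [M HM] := ccont_bounded b cphi.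
have i1 := cintegrableM_bounded (@measurableT _ T) ki (ccont_cmeasurable mt cphi)
  (fun x _ kx => HM _ (tb x kx)).
have i2 := cintegrableM_bounded (@measurableT _ T) ki' (ccont_cmeasurable mt cphi)
  (fun x _ kx => HM _ (tb' x kx)).
rewrite /kernel_functional -[X in _ - X]mul1r -mulNr -cintZ // -cintD //.
  by apply: eq_cint => x _; ring.
exact: cintegrableZ.
Qed.

Lemma ae_product (P Q : R -> Prop) : {ae mu, forall x, P x} -> {ae mu, forall x, Q x} ->
  {ae (mu \x mu)%E, forall p : R * R, P p.1 /\ Q p.2}.
Proof.
move=> [N1 [mN1 N10 H1]] [N2 [mN2 N20 H2]].
exists (N1 `*` setT `|` setT `*` N2); split.
- by apply: measurableU; exact: measurableX.
- apply/eqP; rewrite eq_le measure_ge0 andbT.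
  apply: le_trans (measureU2 _ _ _) _; try exact: measurableX.
  have E1 : (mu \x mu)%E (N1 `*` setT) = 0%E.
    by rewrite [LHS](product_measure1E _ _ mN1 measurableT) [X in (X * _)%E]N10 mul0e.
  have E2 : (mu \x mu)%E (setT `*` N2) = 0%E.
    by rewrite [LHS](product_measure1E _ _ measurableT mN2) [X in (_ * X)%E]N20 mule0.
  by rewrite [X in (X + _)%E]E1 [X in (_ + X)%E]E2 adde0.
- move=> p /= /not_andP[h|h]; [left|right]; split => //; [exact: H1|exact: H2].
Qed.

End SpectralUniqueness.

(** * Uniqueness *)

Section Uniqueness.
Context {R : realType}.
Local Notation C := (R[i]).
Local Notation mu := (@lebesgue_measure R).

Lemma cint_ae0 d (T : measurableType d) (nu : {measure set T -> \bar R}) (h : T -> C) :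
  cmeasurable setT h -> {ae nu, forall x, h x = 0} -> cint nu setT h = 0.
Proof.
move=> [m1 m2] h0.
have E (k : T -> R) : measurable_fun setT k -> {ae nu, forall x, k x = 0} ->
    \int[nu]_x k x = 0.
  move=> mk k0; rewrite /Rintegral (@ae_eq_integral _ _ _ _ _ (cst 0%E)) //.
  - by rewrite integral0.
  - exact/measurable_EFinP.
  - by apply: filterS k0 => x /= ->.
by apply: complex_eq; apply: E => //; apply: filterS h0 => x ->.
Qed.

Variable a : R.
Hypotheses (a_gt0 : 0 < a) (a_ge : 2 * pi <= 5 * a).

Lemma delay_functional_bounded f g : delay_supported a f -> delay_supported a g ->
  bounded_functional (pi - a) (delay_functional a f g).
Proof.
move=> Df Dg; apply: bounded_functionalD; apply: kernel_functional_bounded.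
- by case: Df.
- exact: single_phase_measurable.
- by move=> x; exact: single_phase.
- exact: double_kernel_cintegrable.
- exact: measurable_double_phase.
- by move=> p; exact: double_kernel_phase.
Qed.

Variables (f g ft gt : R -> C).
Hypotheses (Df : delay_supported a f) (Dg : delay_supported a g).
Hypotheses (Dft : delay_supported a ft) (Dgt : delay_supported a gt).

Let k1 t := f t + -1 * ft t.
Let k2 p := double_kernel a f g p + -1 * double_kernel a ft gt p.
Let S1 := kernel_functional mu k1 (fun t => pi + a - 2 * t).
Let S2 := kernel_functional (mu \x mu)%E k2 (fun p => pi - 2 * (p.1 - p.2)).

Let k1_neq0 t : k1 t != 0 -> (f t != 0) || (ft t != 0).
Proof.
by apply: contraR; rewrite negb_or !negbK => /andP[/eqP h1 /eqP h2]; rewrite /k1 h1 h2 mulr0 addr0.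
Qed.

Let k2_neq0 p : k2 p != 0 -> (double_kernel a f g p != 0) || (double_kernel a ft gt p != 0).
Proof.
by apply: contraR; rewrite negb_or !negbK => /andP[/eqP h1 /eqP h2]; rewrite /k2 h1 h2 mulr0 addr0.
Qed.

Let k2_support p : k2 p != 0 -> [/\ a < p.2, p.2 <= p.1 - a & p.1 < pi].
Proof. by move=> /k2_neq0 /orP[]; exact: double_kernel_neq0. Qed.

Let k1i : cintegrable mu setT k1.
Proof. by case: Df Dft => h _ [h' _]; apply: cintegrableD => //; exact: cintegrableZ. Qed.

Let k2i : cintegrable (mu \x mu)%E setT k2.
Proof.
by apply: cintegrableD => //; [|apply: cintegrableZ => //]; exact: double_kernel_cintegrable.
Qed.

Let S_continuous : continuous_functional (pi - a) (fun phi => S1 phi + S2 phi).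
Proof.
apply: continuous_functionalD; apply: kernel_functional_continuous => //.
- exact: single_phase_measurable.
- by move=> t /k1_neq0 /orP[]; exact: single_phase.
- exact: measurable_double_phase.
- by move=> p /k2_neq0 /orP[]; exact: double_kernel_phase.
Qed.

Let S_diff phi : ccont phi ->
  S1 phi + S2 phi = delay_functional a f g phi - delay_functional a ft gt phi.
Proof.
move=> cphi; rewrite /S1 /S2 /k1 /k2.
rewrite (@kernel_functionalB _ _ _ _ _ _ _ (pi - a)) //; first last.
- by move=> x; exact: single_phase.
- by move=> x; exact: single_phase.
- exact: single_phase_measurable.
- by case: Dft.
- by case: Df.
rewrite (@kernel_functionalB _ _ _ _ _ _ _ (pi - a)) //; first last.
- by move=> p; exact: double_kernel_phase.
- by move=> p; exact: double_kernel_phase.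
- exact: measurable_double_phase.
- exact: double_kernel_cintegrable.
- exact: double_kernel_cintegrable.
by rewrite /delay_functional; ring.
Qed.

Hypothesis fun_eq : forall w, delay_functional a f g (expf w) = delay_functional a ft gt (expf w).

Let S_halfline c : S1 (fun x => (halfline c x)%:C) + S2 (fun x => (halfline c x)%:C) = 0.
Proof.
apply: (functional_halfline S_continuous) => w.
by rewrite S_diff ?fun_eq ?subrr //; exact: ccont_expf.
Qed.

(** Here the threshold [pi + a - 2 x] is below [2 a - pi], hence below every phase of the double
    integral. The test function vanishes at those phases, which isolates the single integral. *)
Lemma potential_eq_right : {ae mu, forall x, x \in `]pi - a / 2, pi[ -> f x = ft x}.
Proof.
have : {ae mu, forall x, x \in `]pi - a / 2, pi[ -> k1 x = 0}.
  apply: (@ae_eq0_of_halfline _ k1 (pi + a) _ _ 0) => // x.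
  rewrite in_itv /= => /andP[x1 x2].
  have := S_halfline (pi + a - 2 * x); rewrite (_ : S2 _ = 0) ?addr0 //.
  apply: (cint_ae0 _ _).
    apply: cmeasurableM (cintegrable_cmeasurable k2i) _.
    split; last by exact: measurable_cst.
    apply: (measurableT_comp (f := halfline (pi + a - 2 * x))).
      exact: measurable_halfline.
    exact: measurable_double_phase.
  apply: nearW => p; have [->|/k2_support[h1 h2 h3]] := eqVneq (k2 p) 0.
    by rewrite mul0r.
  rewrite /halfline; have c1 : pi + a - 2 * x < pi - 2 * (p.1 - p.2) by have := a_gt0; lra.
  by rewrite ltNge (ltW c1) /= gt_eqF // mulr0.
apply: filterS; first exact: (ae_filter_ringOfSetsType mu).
by move=> x H xI; apply/eqP; rewrite -subr_eq0 -mulN1r; apply/eqP; exact: H.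
Qed.

(** Here the threshold exceeds [pi - 2 a], so the test function is 1 at every phase of the double
    integral, whose contribution is the same for all these [x]. *)
Lemma potential_eq_left : {ae mu, forall x, x \in `]a, 3 * a / 2[ -> f x = ft x}.
Proof.
have : {ae mu, forall x, x \in `]a, 3 * a / 2[ -> k1 x = 0}.
  apply: (@ae_eq0_of_halfline _ k1 (pi + a) _ _ (- cint (mu \x mu)%E setT k2)) => // x.
  rewrite in_itv /= => /andP[x1 x2].
  have /eqP := S_halfline (pi + a - 2 * x); rewrite addr_eq0 => /eqP E.
  apply: (etrans E); congr (- _); apply: eq_cint => p _.
  have [->|/k2_support[h1 h2 h3]] := eqVneq (k2 p) 0; first by rewrite mul0r.
  rewrite /halfline; have -> : pi - 2 * (p.1 - p.2) < pi + a - 2 * x by have := a_gt0; lra.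
  by rewrite mulr1.
apply: filterS; first exact: (ae_filter_ringOfSetsType mu).
by move=> x H xI; apply/eqP; rewrite -subr_eq0 -mulN1r; apply/eqP; exact: H.
Qed.

(** On the support of the double kernels [t >= s + a > 2 a] and [s <= t - a < pi - a]. By [a_ge] the
    first variable falls in the range of [potential_eq_right] and the second where [g] and [gt]
    agree, so the quadratic terms cancel and the half-line test works on all of []a, pi[]. *)
Lemma potential_eq : {ae mu, forall x, x \in `]a, 3 * a / 2[ -> g x = gt x} ->
  {ae mu, forall x, x \in `]a, pi[ -> f x = ft x}.
Proof.
move=> gE; have := ae_product potential_eq_right gE => k2ae.
have {}k2ae : {ae (mu \x mu)%E, forall p, k2 p = 0}.
  apply: filterS k2ae; first exact: (ae_filter_ringOfSetsType (mu \x mu)%E).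
  move=> p [H1 H2]; apply/eqP; apply: contraT => k0; have [h1 h2 h3] := k2_support k0.
  move: k0; rewrite /k2 /double_kernel H1 ?H2 ?mulN1r ?subrr ?eqxx //.
    by rewrite in_itv /=; apply/andP; split => //; have := a_ge; lra.
  by rewrite in_itv /=; apply/andP; split => //; have := a_ge; lra.
have : {ae mu, forall x, x \in `]a, pi[ -> k1 x = 0}.
  apply: (@ae_eq0_of_halfline _ k1 (pi + a) _ _ 0) => // x _.
  have := S_halfline (pi + a - 2 * x); rewrite (_ : S2 _ = 0) ?addr0 //.
  apply: (cint_ae0 _ _).
    apply: cmeasurableM (cintegrable_cmeasurable k2i) _.
    split; last by exact: measurable_cst.
    apply: (measurableT_comp (f := halfline (pi + a - 2 * x))).
      exact: measurable_halfline.
    exact: measurable_double_phase.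
  apply: filterS k2ae; first exact: (ae_filter_ringOfSetsType (mu \x mu)%E).
  by move=> p ->; rewrite mul0r.
apply: filterS; first exact: (ae_filter_ringOfSetsType mu).
by move=> x H xI; apply/eqP; rewrite -subr_eq0 -mulN1r; apply/eqP; exact: H.
Qed.

End Uniqueness.

(** * From the two spectra to two identities of functionals *)

Section Assembly.
Context {R : realType}.
Local Notation C := (R[i]).
Local Notation mu := (@lebesgue_measure R).
Variable a : R.
Hypotheses (a_gt0 : 0 < a) (a_ge : 2 * pi <= 5 * a) (a_lt : 2 * a < pi).

Lemma fundamental_combination q p Y l (c : C) : admissible a q p ->
  fundamental_matrix a q p Y -> c * c = -1 ->
  combination c (fun x => Y x l) pi = expf (c * l) pi +
    delay_functional a (delay_potential a (- c) p q) (delay_potential a c p q) (expf (c * l)).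
Proof.
move=> adm YF cc; have [sol Y0] := YF l.
have cc' : - c * - c = -1 by rewrite mulrNN.
have s1 := system_delay_solution cc a_gt0 adm sol Y0.
have s2 := system_delay_solution cc' a_gt0 adm sol Y0.
rewrite opprK mulNr in s2.
have a_pi : a < pi by have := a_gt0; have := a_lt; lra.
have pi_3a : pi <= 3 * a by have := a_gt0; have := a_ge; lra.
by apply: (delay_solution_pi a_gt0 a_pi pi_3a _ _ s1 s2); exact: delay_potential_supported.
Qed.

(** The index [nu = 2] selects the first column, the one from which [combination] is built. *)
Lemma char_fun1 Y l : 2 * char_fun Y 2 1 l =
  combination 'i%C (fun x => Y x l) pi + combination (- 'i%C) (fun x => Y x l) pi :> C.
Proof. by rewrite /char_fun /combination /=; ring. Qed.

Lemma char_fun2 Y l : 2 * 'i%C * char_fun Y 2 2 l =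
  combination 'i%C (fun x => Y x l) pi - combination (- 'i%C) (fun x => Y x l) pi :> C.
Proof. by rewrite /char_fun /combination /=; ring. Qed.

(** The terms [e^(i l pi)] and [e^(- i l pi)] do not depend on the potential and cancel. [P]
    compares the functionals of [u] and [N] those of [v]; each spectrum makes one of [P + N] and
    [P - N], with [N] reflected, vanish on all exponentials. *)
Lemma potentials_eq q p qt pt (lam1 lam2 : int -> C) :
  admissible a q p -> admissible a qt pt ->
  is_spectrum a q p 2 1 lam1 -> is_spectrum a q p 2 2 lam2 ->
  is_spectrum a qt pt 2 1 lam1 -> is_spectrum a qt pt 2 2 lam2 ->
  forall w (c := 'i%C : C),
  delay_functional a (delay_potential a (- c) p q) (delay_potential a c p q) (expf w) =
  delay_functional a (delay_potential a (- c) pt qt) (delay_potential a c pt qt) (expf w) /\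
  delay_functional a (delay_potential a c p q) (delay_potential a (- c) p q) (expf w) =
  delay_functional a (delay_potential a c pt qt) (delay_potential a (- c) pt qt) (expf w).
Proof.
move=> adm admt [Y1 [F1 Z1 s1]] [Y2 [F2 Z2 s2]] [T1 [G1 X1 t1]] [T2 [G2 X2 t2]] w0 c.
pose f := delay_potential a (- c) p q; pose g := delay_potential a c p q.
pose ft := delay_potential a (- c) pt qt; pose gt := delay_potential a c pt qt.
have Df : delay_supported a f by exact: delay_potential_supported.
have Dg : delay_supported a g by exact: delay_potential_supported.
have Dft : delay_supported a ft by exact: delay_potential_supported.
have Dgt : delay_supported a gt by exact: delay_potential_supported.
have cc : c * c = -1 by exact: mulii.
have cc' : - c * - c = -1 by rewrite mulrNN.
pose P phi := delay_functional a f g phi + -1 * delay_functional a ft gt phi.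
pose N phi := delay_functional a g f phi + -1 * delay_functional a gt ft phi.
have bf h1 h2 : delay_supported a h1 -> delay_supported a h2 ->
    bounded_functional (pi - a) (delay_functional a h1 h2).
  exact: delay_functional_bounded.
have HP : bounded_functional (pi - a) P.
  by apply: bounded_functionalD; [|apply: bounded_functionalZ]; exact: bf.
have HN : bounded_functional (pi - a) N.
  by apply: bounded_functionalD; [|apply: bounded_functionalZ]; exact: bf.
(* The sign [s] is 1 for the first spectrum and -1 for the second; [N] is reflected because [v]
   carries the exponent [- i l]. *)
have HM (s : C) : bounded_functional (pi - a)
    (fun phi => P phi + s * N (fun x => phi (- x))).
  apply: bounded_functionalD => //; apply: bounded_functionalZ.
  exact: bounded_functional_reflect.
have b0 : 0 <= pi - a :> R by have := a_gt0; have := a_lt; lra.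
have b2 : pi - a < 2 :> R by have := @pi_lt_10_3 R; have := a_ge; lra.
have refl (w : C) : (fun x => expf w (- x)) = expf (- w) by apply/funext => x; rewrite expfN.
have combE q' p' Y l : admissible a q' p' -> fundamental_matrix a q' p' Y ->
    combination c (fun x => Y x l) pi = expf (c * l) pi +
      delay_functional a (delay_potential a (- c) p' q') (delay_potential a c p' q') (expf (c * l)) /\
    combination (- c) (fun x => Y x l) pi = expf (- (c * l)) pi +
      delay_functional a (delay_potential a c p' q') (delay_potential a (- c) p' q') (expf (- (c * l))).
  move=> ad FY; split; first exact: fundamental_combination.
  by rewrite (fundamental_combination _ ad FY cc') mulNr opprK.
have M1 : forall w, P (expf w) + 1 * N (fun x => expf w (- x)) = 0.
  apply: (functional_eq0_of_spectrum (kappa := 2) b0 b2 (HM 1) _ Z1 X1 s1) => l.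
  rewrite refl mulrBr !char_fun1.
  have [-> ->] := combE _ _ _ l adm F1; have [-> ->] := combE _ _ _ l admt G1.
  by rewrite /P /N -/f -/g -/ft -/gt; ring.
have M2 : forall w, P (expf w) + -1 * N (fun x => expf w (- x)) = 0.
  apply: (functional_eq0_of_spectrum (kappa := 2 * 'i%C) b0 b2 (HM (-1)) _ Z2 X2 s2) => l.
  rewrite refl mulrBr !char_fun2.
  have [-> ->] := combE _ _ _ l adm F2; have [-> ->] := combE _ _ _ l admt G2.
  by rewrite /P /N -/f -/g -/ft -/gt; ring.
have PN w : P (expf w) = 0 /\ N (expf (- w)) = 0.
  have := M1 w; have := M2 w; rewrite refl mul1r mulN1r => /eqP; rewrite subr_eq0 => /eqP ->.
  rewrite -mulr2n => /eqP; rewrite mulrn_eq0 /= => /eqP ->; by [].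
split; apply/eqP; rewrite -subr_eq0; apply/eqP.
  by have [h _] := PN w0; rewrite -[RHS]h /P mulN1r.
by have [_ h] := PN (- w0); rewrite opprK in h; rewrite -[RHS]h /N mulN1r.
Qed.

End Assembly.

Theorem theorem3p1 (R : realType) (a : R) (q p qt pt : R -> R[i])
    (lam1 lam2 lamt1 lamt2 : int -> R[i]) :
  2 * pi / 5 <= a -> a < pi / 2 ->
  admissible a q p -> admissible a qt pt ->
  is_spectrum a q p 2 1 lam1 -> is_spectrum a q p 2 2 lam2 ->
  is_spectrum a qt pt 2 1 lamt1 -> is_spectrum a qt pt 2 2 lamt2 ->
  (forall n : int, lam1 n = lamt1 n) ->
  (forall n : int, lam2 n = lamt2 n) ->
  {ae @lebesgue_measure R, forall x, x \in `[a, pi] ->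
    q x = qt x /\ p x = pt x}.
Proof.
move=> a1 a2 adm admt S1 S2 T1 T2 /funext E1 /funext E2.
subst lamt1 lamt2.
have pi0 := pi_gt0 R.
have a_gt0 : 0 < a by lra.
have a_ge : 2 * pi <= 5 * a by lra.
have a_lt : 2 * a < pi by lra.
have E := potentials_eq a_gt0 a_ge a_lt adm admt S1 S2 T1 T2.
pose c : R[i] := 'i%C.
pose f := delay_potential a (- c) p q; pose g := delay_potential a c p q.
pose ft := delay_potential a (- c) pt qt; pose gt := delay_potential a c pt qt.
have Df : delay_supported a f by exact: delay_potential_supported.
have Dg : delay_supported a g by exact: delay_potential_supported.
have Dft : delay_supported a ft by exact: delay_potential_supported.
have Dgt : delay_supported a gt by exact: delay_potential_supported.
have E1 w : delay_functional a f g (expf w) = delay_functional a ft gt (expf w).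
  by case: (E w).
have E2 w : delay_functional a g f (expf w) = delay_functional a gt ft (expf w).
  by case: (E w).
(* Both left ranges come first: the full statement for [f] uses the left values of [g], and
   conversely. *)
have fL := potential_eq_left a_gt0 Df Dg Dft Dgt E1.
have gL := potential_eq_left a_gt0 Dg Df Dgt Dft E2.
have fE := potential_eq a_gt0 a_ge Df Dg Dft Dgt E1 gL.
have gE := potential_eq a_gt0 a_ge Dg Df Dgt Dft E2 fL.
(* [delay_potential] is cut to 0 at [a] and [pi], so equality there carries no information on [p]
   and [q]. *)
have ends : {ae @lebesgue_measure R, forall x, x <> a /\ x <> pi}.
  by apply: filterS2 (ae_neq a) (ae_neq pi); first exact: (ae_filter_ringOfSetsType (@lebesgue_measure R)).
apply: filterS3 fE gE ends; first exact: (ae_filter_ringOfSetsType (@lebesgue_measure R)).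
move=> x fx gx [xa xpi]; rewrite in_itv /= => /andP[ax xp].
have ax' : a < x by rewrite lt_neqAle ax andbT; apply/eqP => h; apply: xa.
have xp' : x < pi by rewrite lt_neqAle xp andbT; apply/eqP.
have xI : x \in `]a, pi[ by rewrite in_itv /= ax' xp'.
have {fx} := fx xI; have {gx} := gx xI.
rewrite /f /g /ft /gt /delay_potential ax' xp' /= => hg hf.
(* The sum of the two combinations is [2 p]; then [q] follows from [g], since ['i] is not 0. *)
have pE : p x = pt x.
  have : 2 * p x = 2 * pt x.
    rewrite (_ : 2 * p x = (p x + c * q x) + (p x + - c * q x)); last by ring.
    by rewrite hg hf; ring.
  by apply: mulfI; rewrite pnatr_eq0.
split => //; move: hg; rewrite pE => /addrI; apply: mulfI.
by apply/eqP => h; have := normc_i (R := R); rewrite -/c h Normc.normc0 => /eqP;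
  rewrite eq_sym oner_eq0.
Qed.
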